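(* For every $z\in S_{\ell_1''}\setminus S_{\ell_1}$, the fiber $\mathcal{M}_z$ of $\mathcal{M}(\mathcal{A}_u(B_{\ell_1}))$ over $z$ satisfies $\mathrm{Card}(\mathcal{M}_z)\ge\mathfrak{c}$.
   Context: Here $\ell_1$ is the complex Banach space of absolutely summable complex sequences, $B_{\ell_1}$ and $S_{\ell_1}$ its open unit ball and unit sphere, $\ell_1'=\ell_\infty$ its dual, $\ell_1''$ its bidual with unit sphere $S_{\ell_1''}$ and closed unit ball $\overline{B}_{\ell_1''}$; $\ell_1$ (and so $S_{\ell_1}$) is regarded as a subset of $\ell_1''$ via the canonical embedding. $\mathfrak{c}$ is the cardinality of the continuum. $\mathcal{A}_u(B_{\ell_1})$ is the complex Banach algebra of all holomorphic functions $f\colon B_{\ell_1}\to\mathbb{C}$ that are uniformly continuous with respect to the norm of $\ell_1$, with the supremum norm on $B_{\ell_1}$. Its spectrum $\mathcal{M}(\mathcal{A}_u(B_{\ell_1}))$ is the set of all nonzero algebra homomorphisms $\varphi\colon\mathcal{A}_u(B_{\ell_1})\to\mathbb{C}$. The (restrictions to $B_{\ell_1}$ of the) elements of $\ell_1'$ belong to $\mathcal{A}_u(B_{\ell_1})$, and for each $\varphi$ in the spectrum the restriction $\varphi|_{\ell_1'}$ is an element of $\overline{B}_{\ell_1''}$. For $z\in\overline{B}_{\ell_1''}$ the fiber over $z$ is $\mathcal{M}_z=\{\varphi\in\mathcal{M}(\mathcal{A}_u(B_{\ell_1})):\varphi|_{\ell_1'}=z\}$. *)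

(* Defs.v *)
From HB Require Import structures.
From mathcomp Require Import all_boot all_order all_algebra.
From mathcomp Require Import all_classical all_reals all_analysis.
From mathcomp Require Import complex.

Set Implicit Arguments.
Unset Strict Implicit.
Unset Printing Implicit Defensive.

Import Order.TTheory GRing.Theory Num.Theory.
Import numFieldNormedType.Exports.

Local Open Scope classical_set_scope.
Local Open Scope ring_scope.
Local Open Scope complex_scope.

(* R[i]^o, the one-dimensional normed space over the complex field R[i]. *)
Notation Cplx R := (R[i]^o).

(* In a [normedModType R[i]] the norm is a (nonnegative real) element of R[i];
   [rnorm x] is the same number as an element of R, see [rnormE]. *)
Definition rnorm (R : realType) (V : normedModType R[i]) (x : V) : R :=
  complex.Re `|x|.

Section RealNorm.
Context {R : realType} {V : normedModType R[i]}.
Implicit Types (x y : V).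

Lemma rnormE x : (rnorm x)%:C = `|x|.
Proof. by rewrite /rnorm RRe_real// normr_real. Qed.

Lemma rnorm_ge0 x : 0 <= rnorm x.
Proof. by rewrite -lecR rnormE normr_ge0. Qed.

Lemma rnormD x y : rnorm (x + y) <= rnorm x + rnorm y.
Proof. by rewrite -lecR rmorphD/= !rnormE ler_normD. Qed.

Lemma rnormZ (a : Cplx R) x : rnorm (a *: x) = rnorm a * rnorm x.
Proof.
by apply: (@complexI R); rewrite rmorphM/= !rnormE normrZ.
Qed.

Lemma rnorm0 : rnorm (0 : V) = 0.
Proof. by rewrite /rnorm normr0. Qed.

Lemma rnorm0_eq0 x : rnorm x = 0 -> x = 0.
Proof. by move=> x0; apply/eqP; rewrite -normr_eq0 -rnormE x0. Qed.

End RealNorm.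

Section EllOne.
Variable R : realType.
Local Notation C := (Cplx R).

Definition l1_seq : {pred nat -> C} :=
  mem [set x : nat -> C | cvgn (series (fun n => rnorm (x n)))].

Lemma l1_seq_submod_closed : submod_closed l1_seq.
Proof.
split=> [|a x y xs ys].
  apply/mem_set => /=; rewrite (_ : (fun _ => _) = cst 0); last by apply/funext => n; rewrite rnorm0.
  apply/cvg_ex; exists 0; rewrite (_ : series _ = cst 0); first exact: cvg_cst.
  by apply/funext => n; rewrite /series/= big1.
have xl : cvgn (series (fun n => rnorm (x n))) by apply: set_mem.
have yl : cvgn (series (fun n => rnorm (y n))) by apply: set_mem.
pose v := (rnorm (a : C) *: (fun n => rnorm (x n)) : nat -> R)
  + (fun n => rnorm (y n)).
have cv : cvgn (series v) by apply: is_cvg_seriesD => //; exact: is_cvg_seriesZ.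
apply/mem_set => /=; refine (series_le_cvg _ _ _ cv) => n.
- exact: rnorm_ge0.
- by rewrite addr_ge0// ?mulr_ge0// rnorm_ge0.
- by rewrite (le_trans (rnormD _ _))// rnormZ.
Qed.

HB.instance Definition _ :=
  GRing.isSubmodClosed.Build _ _ l1_seq l1_seq_submod_closed.

Record l1 := L1 { l1_val :> nat -> C; _ : l1_val \in l1_seq }.

HB.instance Definition _ := [isSub for l1_val].
HB.instance Definition _ := [Choice of l1 by <:].
HB.instance Definition _ := [SubChoice_isSubLmodule of l1 by <:].

Definition l1_rnorm (x : l1) : R := limn (series (fun n => rnorm (x n))).

Lemma l1_cvg (x : l1) : cvgn (series (fun n => rnorm (x n))).
Proof. by case: x => x /= /set_mem. Qed.
Arguments l1_cvg : clear implicits.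

Definition l1_norm (x : l1) : R[i] := (l1_rnorm x)%:C.

Lemma l1_normD x y : l1_norm (x + y) <= l1_norm x + l1_norm y.
Proof.
rewrite /l1_norm -rmorphD/= lecR /l1_rnorm -lim_seriesD; try exact: l1_cvg.
apply: ler_lim; first exact: l1_cvg.
  by apply: is_cvg_seriesD; exact: l1_cvg.
by apply: nearW => n; apply: ler_sum => i _; exact: rnormD.
Qed.

Lemma l1_normZ (a : R[i]) x : l1_norm (a *: x) = `|a| * l1_norm x.
Proof.
rewrite -[`|a|]/(`|a : C|) -rnormE /l1_norm -rmorphM/=; congr (_%:C).
rewrite /l1_rnorm -[RHS]lim_seriesZ; last exact: l1_cvg.
by congr (limn (series _)); apply/funext => n /=; rewrite rnormZ.
Qed.

Lemma l1_norm_eq0 x : l1_norm x = 0 -> x = 0.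
Proof.
move=> /(@complexI R) x0; apply/val_inj/funext => n /=; apply/rnorm0_eq0.
apply/eqP; rewrite eq_le rnorm_ge0 andbT -x0.
have /nondecreasing_cvgn_le : {homo series (fun n => rnorm (x n)) :
    m k / (m <= k)%N >-> m <= k}.
  apply/nondecreasing_seqP => k.
  by rewrite /series/= big_nat_recr//= lerDl rnorm_ge0.
move=> /(_ (l1_cvg x) n.+1); apply: le_trans.
by rewrite /series/= big_nat_recr//= lerDr sumr_ge0// => i _; exact: rnorm_ge0.
Qed.

HB.instance Definition _ :=
  Lmodule_isNormed.Build R[i] l1 l1_normD l1_normZ l1_norm_eq0.

Lemma l1_normE (x : l1) : rnorm x = limn (series (fun n => rnorm (x n))).
Proof. by []. Qed.

End EllOne.

Section Dual.
Context {R : realType}.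
Variable V : normedModType R[i].
Local Notation C := (Cplx R).

Definition dual_fun : {pred V -> C} :=
  mem [set f : V -> C | linear f /\ continuous f].

Lemma dual_fun_submod_closed : submod_closed dual_fun.
Proof.
split=> [|a f g /set_mem/= [lf cf] /set_mem/= [lg cg]]; apply/mem_set => /=.
  split; last exact: cst_continuous.
  by move=> a x y; rewrite /= scaler0 addr0.
have E z : (a *: f + g) z = a *: f z + g z by [].
split=> [b x y|x].
  rewrite !E lf lg !scalerDr (addrACA (a *: (b *: f x))); congr (_ + _ + _).
  by rewrite !scalerA (mulrC a).
apply: cvgD; last exact: cg.
exact: (cvgZl_tmp (k := a) (cf x)).
Qed.

HB.instance Definition _ :=
  GRing.isSubmodClosed.Build _ _ dual_fun dual_fun_submod_closed.

Record dual := Dual { dual_val :> V -> C; _ : dual_val \in dual_fun }.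

HB.instance Definition _ := [isSub for dual_val].
HB.instance Definition _ := [Choice of dual by <:].
HB.instance Definition _ := [SubChoice_isSubLmodule of dual by <:].

Lemma dual_linear (f : dual) : linear f.
Proof. by case: f => f /= /set_mem[]. Qed.

Lemma dual_continuous (f : dual) : continuous f.
Proof. by case: f => f /= /set_mem[]. Qed.

HB.instance Definition _ (f : dual) :=
  GRing.isLinear.Build R[i] V C *:%R f (dual_linear f).

Definition dual_rnorm (f : dual) : R :=
  sup [set rnorm (f x) | x in [set x | rnorm x <= 1]].

Lemma dual_bounded (f : dual) :
  has_ubound [set rnorm (f x) | x in [set x | rnorm x <= 1]].
Proof.
have /(_ 1)[M BM] : forall r, exists M, forall x, `|x| <= r -> `|f x| <= M.
  apply/bounded_funP; apply: (@continuous_linear_bounded _ _ _ 0 f).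
  exact: dual_continuous.
exists (complex.Re M) => _ [x /= x1 <-].
have : `|f x| <= M by apply: BM; rewrite -rnormE lecR.
by rewrite /rnorm lecE => /andP[_].
Qed.

Lemma dual_rnorm_ge (f : dual) x : rnorm x <= 1 -> rnorm (f x) <= dual_rnorm f.
Proof. by move=> x1; apply: ub_le_sup; [exact: dual_bounded|exists x]. Qed.

Lemma dual_range_neq0 (f : dual) :
  [set rnorm (f x) | x in [set x | rnorm x <= 1]] !=set0.
Proof. by exists (rnorm (f 0)); exists 0 => //=; rewrite rnorm0. Qed.

Definition dual_norm (f : dual) : R[i] := (dual_rnorm f)%:C.

Lemma dual_normD f g : dual_norm (f + g) <= dual_norm f + dual_norm g.
Proof.
rewrite /dual_norm -rmorphD/= lecR.
apply: ge_sup; [exact: dual_range_neq0|move=> _ [x /= x1 <-]].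
by rewrite (le_trans (rnormD _ _))// lerD// dual_rnorm_ge.
Qed.

Lemma dual_normZ_le (a : C) f : dual_rnorm (a *: f) <= rnorm a * dual_rnorm f.
Proof.
apply: ge_sup; [exact: dual_range_neq0|move=> _ [x /= x1 <-]].
by rewrite rnormZ ler_wpM2l ?rnorm_ge0// dual_rnorm_ge.
Qed.

Lemma dual_normZ (a : R[i]) f : dual_norm (a *: f) = `|a| * dual_norm f.
Proof.
rewrite -[`|a|]/(`|a : C|) -rnormE /dual_norm -rmorphM/=; congr (_%:C).
have [->|a0] := eqVneq (a : C) 0.
  rewrite rnorm0 mul0r scale0r; apply/eqP; rewrite eq_le; apply/andP; split.
    by apply: ge_sup; [exact: dual_range_neq0|move=> _ [x /= x1 <-]]; rewrite rnorm0.
  by rewrite (le_trans _ (@dual_rnorm_ge 0 0 _)) ?rnorm0.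
have ra : 0 < rnorm (a : C).
  by rewrite lt_neqAle rnorm_ge0 andbT; apply: contra_neq a0 => /esym/rnorm0_eq0.
apply/eqP; rewrite eq_le dual_normZ_le/=.
rewrite -ler_pdivlMl// -[X in dual_rnorm X <= _](scalerK a0).
rewrite (le_trans (dual_normZ_le _ _))// ler_wpM2r//.
  rewrite (le_trans _ (@dual_rnorm_ge (a *: f) 0 _)) ?rnorm0//.
  exact: rnorm_ge0.
rewrite -(ler_pM2l ra) -rnormZ -[_ *: _]/(_ * _) mulfV// mulfV ?gt_eqF//.
by rewrite /rnorm normr1.
Qed.

Lemma dual_norm_eq0 f : dual_norm f = 0 -> f = 0.
Proof.
move=> /(@complexI R) f0; apply/val_inj/funext => x /=; apply/rnorm0_eq0.
have [->|x0] := eqVneq x 0; first by rewrite linear0 rnorm0.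
have rx : 0 < rnorm x.
  by rewrite lt_neqAle rnorm_ge0 andbT; apply: contra_neq x0 => /esym/rnorm0_eq0.
have rrE : rnorm ((rnorm x)^-1%:C : C) = (rnorm x)^-1.
  by rewrite /rnorm ger0_norm// lecR invr_ge0 ltW.
have := @dual_rnorm_ge f ((rnorm x)^-1%:C *: x).
rewrite linearZ/= !rnormZ rrE mulVf ?gt_eqF// => /(_ (lexx _)).
rewrite f0 pmulr_rle0 ?invr_gt0// => fx.
by apply/eqP; rewrite eq_le fx rnorm_ge0.
Qed.

HB.instance Definition _ :=
  Lmodule_isNormed.Build R[i] dual dual_normD dual_normZ dual_norm_eq0.

Lemma dual_normE (f : dual) :
  rnorm f = sup [set rnorm (f x) | x in [set x | rnorm x <= 1]].
Proof. by []. Qed.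

Lemma dual_le (f : dual) x : rnorm (f x) <= rnorm f * rnorm x.
Proof.
have [->|x0] := eqVneq x 0; first by rewrite linear0 !rnorm0 mulr0.
have rx : 0 < rnorm x.
  by rewrite lt_neqAle rnorm_ge0 andbT; apply: contra_neq x0 => /esym/rnorm0_eq0.
have rrE : rnorm ((rnorm x)^-1%:C : C) = (rnorm x)^-1.
  by rewrite /rnorm ger0_norm// lecR invr_ge0 ltW.
have := @dual_rnorm_ge f ((rnorm x)^-1%:C *: x).
rewrite linearZ/= !rnormZ rrE mulVf ?gt_eqF// => /(_ (lexx _)).
by rewrite ler_pdivrMl// mulrC.
Qed.

End Dual.

Notation bidual V := (dual (dual V)).

Section Bidual.
Context {R : realType} {V : normedModType R[i]}.
Local Notation C := (Cplx R).

Definition eval_at (x : V) : dual V -> C := fun f => f x.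

Lemma eval_at_linear x : linear (eval_at x).
Proof. by []. Qed.

Lemma eval_at_dual x : eval_at x \in @dual_fun R (dual V).
Proof.
apply/mem_set; split; first exact: eval_at_linear.
pose L := GRing.isLinear.Build R[i] (dual V) C *:%R (eval_at x)
  (eval_at_linear x).
pose F : {linear dual V -> C} := HB.pack (eval_at x) L.
apply: (@bounded_linear_continuous R[i] (dual V) C F); apply/bounded_funP => r.
exists (r * `|x|) => f fr; rewrite (@le_trans _ _ (`|f| * `|x|))//.
  by rewrite -!rnormE -rmorphM lecR; exact: dual_le.
exact: ler_wpM2r.
Qed.

Definition bidual_embed (x : V) : bidual V := Dual (eval_at_dual x).

End Bidual.

Section BallAlgebra.
Context {R : realType}.
Variable V : normedModType R[i].
Local Notation C := (Cplx R).

(* V is over the scalar field R[i], so [differentiable] is complex Frechet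
   differentiability. *)
Definition holomorphic_on (D : set V) (F : V -> C) : Prop :=
  forall x, D x -> differentiable F x.

Definition unit_sphere : set V := [set x | rnorm x = 1].

Definition unit_ball : set V := [set x | rnorm x < 1].

Lemma unit_ball_open : open unit_ball.
Proof.
rewrite (_ : unit_ball = ball (0 : V) 1); first exact: ball_open.
rewrite -ball_normE; apply/seteqP; split => x /=;
  by rewrite /unit_ball/= sub0r normrN -[`|x|]rnormE (ltcR (rnorm x) 1).
Qed.

(* The functions live on the ball itself (a subtype of V).  [differentiable]
   expects a function on V, so it is applied to the extension by 0; as the ball
   is open, the values outside of it are irrelevant (see [holomorphic_ext]). *)
Definition Au_fun : {pred unit_ball -> C} :=
  mem [set f : unit_ball -> C | holomorphic_on unit_ball ('valL_(0 : C) f) /\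
                            unif_continuous f].

Lemma unit_ball_ucP (f : unit_ball -> C) : unif_continuous f <->
  forall e : R, 0 < e -> exists2 d : R, 0 < d &
    forall x y : unit_ball, rnorm (val x - val y) < d -> rnorm (f x - f y) < e.
Proof.
have ltC (r : R) (W : normedModType R[i]) (w : W) : (`|w| < r%:C) = (rnorm w < r).
  by rewrite -rnormE ltcR.
have posC (e : R[i]) : 0 < e -> e = (complex.Re e)%:C /\ 0 < complex.Re e.
  move=> e0; have eE : e = (complex.Re e)%:C by rewrite RRe_real// gtr0_real.
  by split=> //; rewrite -ltcR -eE.
split=> [fu e e0|fu A].
  have eC : 0 < e%:C :> R[i] by rewrite ltcR.
  have := entourage_ball C (PosNum eC).
  move=> /fu /= [B + sBA]; rewrite -entourage_ballE => -[d /= /posC[dE d0] sdB].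
  exists (complex.Re d) => // x y; rewrite -ltC -dE => xyd.
  have := sBA (x, y); rewrite /= -!ball_normE/= ltC; apply.
  by apply: sdB; rewrite /= -ball_normE.
rewrite -entourage_ballE => -[e /= /posC[eE e0] sA].
have [d d0 fd] := fu _ e0.
exists [set xy : V * V | ball xy.1 d%:C xy.2].
  have dC : 0 < d%:C :> R[i] by rewrite ltcR.
  exact: (entourage_ball V (PosNum dC)).
move=> [x y] /=; rewrite -ball_normE/= ltC => /fd fxy.
by apply: sA; rewrite /= -ball_normE/= eE ltC.
Qed.

Lemma valL_unit_ball (f : unit_ball -> C) (x : unit_ball) : 'valL_(0 : C) f (val x) = f x.
Proof. by rewrite -[LHS]/(sigL unit_ball ('valL_(0 : C) f) x) valLK. Qed.

Lemma unit_ball_val (x : unit_ball) : unit_ball (val x).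
Proof. by case: x => x /= /set_mem. Qed.

Lemma frechetP (F : V -> C) (x : V) : differentiable F x <->
  exists L : {linear V -> C}, continuous L /\ forall e : R[i], 0 < e ->
    \forall h \near (0 : V), `|F (h + x) - F x - L h| <= e * `|h|.
Proof.
have rw (L : {linear V -> C}) h :
    (F \o shift x - (cst (F x) + L)) h = F (h + x) - F x - L h.
  by rewrite /= opprD addrA.
split=> [/diff_locallyP[cF /eqaddoP dF]|[L [cL dL]]].
  exists ('d F x); split=> // e e0; have := dF e e0.
  by apply: filterS => h; rewrite rw.
have dF : F \o shift x = cst (F x) + L +o_ (0 : V) id.
  by apply/eqaddoP => e e0; have := dL e e0; apply: filterS => h; rewrite rw.
by apply/diff_locallyP; rewrite (diff_unique cL dF).
Qed.

Lemma near_differentiable (F G : V -> C) (x : V) :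
  (\forall y \near x, F y = G y) -> differentiable F x -> differentiable G x.
Proof.
move=> FG /frechetP[L [cL dF]]; apply/frechetP; exists L; split=> // e e0.
have Fx : F x = G x := nbhs_singleton FG.
have FG0 : \forall h \near (0 : V), F (h + x) = G (h + x).
  by move: FG; rewrite (near_shift 0 x); apply: filterS => h /=; rewrite subr0.
by apply: filterS2 FG0 (dF e e0) => h <-; rewrite Fx.
Qed.

Lemma holomorphic_ext (f g : V -> C) : {in unit_ball, f =1 g} ->
  holomorphic_on unit_ball f -> holomorphic_on unit_ball g.
Proof.
move=> fg hf x xB; apply: near_differentiable (hf x xB).
have := open_nbhs_nbhs (conj unit_ball_open xB).
by apply: filterS => y /mem_set/fg.
Qed.

Lemma unit_ball_bounded (f : unit_ball -> C) :
  unif_continuous f -> exists M : R, forall x, rnorm (f x) <= M.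
Proof.
move=> /unit_ball_ucP/(_ 1 ltr01)[d d0 fd].
pose N := (Num.truncn d^-1).+1.
have N0 : 0 < N%:R :> R by rewrite ltr0n.
have Nd : N%:R^-1 < d.
  have /truncn_itv/andP[_ dN] : 0 <= d^-1 by rewrite invr_ge0 ltW.
  by rewrite invf_plt.
have inB (x : unit_ball) (k : nat) : (k <= N)%N ->
    (k%:R / N%:R : R)%:C *: val x \in unit_ball.
  move=> kN; apply/mem_set; rewrite /unit_ball/= rnormZ.
  have -> : rnorm ((k%:R / N%:R : R)%:C : C) = k%:R / N%:R.
    by rewrite /rnorm ger0_norm// lecR divr_ge0.
  apply: le_lt_trans (unit_ball_val x); rewrite ler_piMl ?rnorm_ge0//.
  by rewrite ler_pdivrMr// mul1r ler_nat.
have B0 : (0 : V) \in unit_ball by apply/mem_set; rewrite /unit_ball/= rnorm0.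
pose z : unit_ball := SigSub B0.
exists (rnorm (f z) + N%:R) => x.
suff H k (kN : (k <= N)%N) : rnorm (f (SigSub (inB x k kN))) <= rnorm (f z) + k%:R.
  have := H N (leqnn N); congr (rnorm (f _) <= _); apply: val_inj => /=.
  by rewrite divff ?gt_eqF// scale1r.
elim: k kN => [|k IH] kN.
  rewrite addr0 le_eqVlt; apply/orP; left; apply/eqP; congr (rnorm (f _)).
  by apply: val_inj => /=; rewrite mul0r scale0r.
have kN' : (k <= N)%N := ltnW kN.
set u := SigSub (inB x k.+1 kN); set w := SigSub (inB x k kN').
have uw : rnorm (f u - f w) < 1.
  apply: fd => /=; rewrite -scalerBl -rmorphB/= -mulrBl.
  rewrite -natrB// subSnn mul1r rnormZ.
  have -> : rnorm ((N%:R^-1 : R)%:C : C) = N%:R^-1.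
    by rewrite /rnorm ger0_norm// lecR invr_ge0.
  rewrite (le_lt_trans _ Nd)// ler_piMr ?invr_ge0//.
  exact/ltW/unit_ball_val.
rewrite -(subrK (f w) (f u)) (le_trans (rnormD _ _))//.
by rewrite -natr1 addrA addrC lerD ?IH// ltW.
Qed.

Lemma Au_subring_closed : subring_closed Au_fun.
Proof.
split=> [|f g /set_mem/= [hf uf] /set_mem/= [hg ug]|
          f g /set_mem/= [hf uf] /set_mem/= [hg ug]]; apply/mem_set => /=; split.
- apply: (@holomorphic_ext (cst 1)) => [x /set_mem xB|x _].
    by rewrite -[x]/(val (SigSub (mem_set xB) : unit_ball)) valL_unit_ball.
  exact: differentiable_cst.
- apply/unit_ball_ucP => e e0; exists 1 => // x y _.
  by rewrite subrr rnorm0.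
- apply: (@holomorphic_ext ('valL_(0 : C) f - 'valL_(0 : C) g)).
    move=> x /set_mem xB; rewrite -[x]/(val (SigSub (mem_set xB) : unit_ball)).
    by rewrite valL_unit_ball -[LHS]/(_ - _) !valL_unit_ball.
  by move=> x xB; apply: differentiableB; [exact: hf|exact: hg].
- apply/unit_ball_ucP => e e0.
  have e20 : 0 < e / 2 by rewrite divr_gt0.
  have [d1 d10 fd] := (unit_ball_ucP f).1 uf _ e20.
  have [d2 d20 gd] := (unit_ball_ucP g).1 ug _ e20.
  exists (Num.min d1 d2); first by rewrite lt_min d10.
  move=> x y; rewrite lt_min => /andP[/fd fxy /gd gxy].
  have -> : (f - g) x - (f - g) y = (f x - f y) + (g y - g x).
    by rewrite -[(f - g) x]/(f x - g x) -[(f - g) y]/(f y - g y) opprB addrACA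
      [- g x + _]addrC [LHS]addrA addrACA addrA.
  rewrite (le_lt_trans (rnormD _ _))// [e]splitr ltrD//.
  by rewrite /rnorm distrC.
- apply: (@holomorphic_ext ('valL_(0 : C) f * 'valL_(0 : C) g)).
    move=> x /set_mem xB; rewrite -[x]/(val (SigSub (mem_set xB) : unit_ball)).
    by rewrite valL_unit_ball -[LHS]/(_ * _) !valL_unit_ball.
  by move=> x xB; apply: differentiableM; [exact: hf|exact: hg].
- apply/unit_ball_ucP => e e0.
  have [Mf fM] := unit_ball_bounded uf; have [Mg gM] := unit_ball_bounded ug.
  pose M := Num.max 1 (Num.max Mf Mg).
  have M0 : 0 < M by rewrite lt_max ltr01.
  have {}fM x : rnorm (f x) <= M by rewrite !le_max fM orbT.
  have {}gM x : rnorm (g x) <= M by rewrite !le_max gM !orbT.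
  have eM0 : 0 < e / 2 / M by rewrite !divr_gt0.
  have [d1 d10 fd] := (unit_ball_ucP f).1 uf _ eM0.
  have [d2 d20 gd] := (unit_ball_ucP g).1 ug _ eM0.
  exists (Num.min d1 d2); first by rewrite lt_min d10.
  move=> x y; rewrite lt_min => /andP[/fd fxy /gd gxy].
  have -> : (f * g) x - (f * g) y = f x *: (g x - g y) + g y *: (f x - f y).
    rewrite -[(f * g) x]/(f x * g x) -[(f * g) y]/(f y * g y).
    by rewrite !scalerBr /GRing.scale/= [g y * f x]mulrC [g y * f y]mulrC subrKA.
  rewrite (le_lt_trans (rnormD _ _))// [e]splitr !rnormZ ltrD//.
    rewrite (@le_lt_trans _ _ (M * rnorm (g x - g y)))//.
      by rewrite ler_wpM2r ?rnorm_ge0.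
    by rewrite mulrC -ltr_pdivlMr.
  rewrite (@le_lt_trans _ _ (M * rnorm (f x - f y)))//.
    by rewrite ler_wpM2r ?rnorm_ge0.
  by rewrite mulrC -ltr_pdivlMr.
Qed.

Lemma dual_Au (F : dual V) : sigL unit_ball (dual_val F) \in Au_fun.
Proof.
apply/mem_set; split.
  apply: (@holomorphic_ext (dual_val F)) => [x /set_mem xB|x xB].
    by rewrite -[x in RHS]/(val (SigSub (mem_set xB) : unit_ball)) valL_unit_ball.
  exact: (@linear_differentiable _ _ _ (dual_val F) x (@dual_continuous _ _ F)).
apply/unit_ball_ucP => e e0; exists (e / (rnorm F + 1)) => [|x y].
  by rewrite divr_gt0// ltr_pwDr// rnorm_ge0.
rewrite ltr_pdivlMr ?ltr_pwDr ?rnorm_ge0// => xy.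
rewrite /sigL/= !set_valE -linearB (le_lt_trans (dual_le _ _))//.
by rewrite (le_lt_trans _ xy)// mulrC ler_wpM2l ?rnorm_ge0// lerDl.
Qed.

Lemma Au_scale_closed (a : R[i]) (f : unit_ball -> C) :
  f \in Au_fun -> a *: f \in Au_fun.
Proof.
move=> fA; rewrite (_ : a *: f = cst (a : C) * f) //.
have [_ _ AM] := Au_subring_closed; apply: AM => //.
apply/mem_set; split.
  apply: (@holomorphic_ext (cst a)) => [x /set_mem xB|x _].
    by rewrite -[x]/(val (SigSub (mem_set xB) : unit_ball)) valL_unit_ball.
  exact: differentiable_cst.
by apply/unit_ball_ucP => e e0; exists 1 => // x y _; rewrite subrr rnorm0.
Qed.

Lemma Au_submod_closed : submod_closed Au_fun.
Proof.
have [A1 AB _] := Au_subring_closed.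
have A0 : 0 \in Au_fun by rewrite -(subrr (1 : unit_ball -> C)); exact: AB.
split=> // a f g fA gA; rewrite -[g]opprK.
by apply: (AB); [exact: Au_scale_closed|rewrite -sub0r; exact: AB].
Qed.

HB.instance Definition _ :=
  GRing.isSubringClosed.Build _ Au_fun Au_subring_closed.
HB.instance Definition _ :=
  GRing.isSubmodClosed.Build _ _ Au_fun Au_submod_closed.

Record Au := MkAu { Au_val :> unit_ball -> C; _ : Au_val \in Au_fun }.

HB.instance Definition _ := [isSub for Au_val].
HB.instance Definition _ := [Choice of Au by <:].
HB.instance Definition _ :=
  GRing.SubChoice_isSubComPzRing.Build _ _ Au (GRing.subringClosedP _).
HB.instance Definition _ := [SubZmodule_isSubLmodule of Au by <:].

Lemma Au_oner_neq0 : 1 != 0 :> Au.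
Proof.
have B0 : (0 : V) \in unit_ball by apply/mem_set; rewrite /unit_ball/= rnorm0.
apply/eqP => /(congr1 (fun f : Au => f (SigSub B0))) /eqP.
by rewrite oner_eq0.
Qed.

HB.instance Definition _ := GRing.PzSemiRing_isNonZero.Build Au Au_oner_neq0.

Lemma Au_scalerAl (a : R[i]) (f g : Au) : a *: (f * g) = a *: f * g.
Proof. by apply/val_inj/funext => x /=; exact: mulrA. Qed.

HB.instance Definition _ := GRing.Lmodule_isLalgebra.Build R[i] Au Au_scalerAl.
HB.instance Definition _ := GRing.Lalgebra_isComAlgebra.Build R[i] Au.

Definition Au_of_dual (F : dual V) : Au := MkAu (dual_Au F).

(* [scalar phi] is C-linearity; phi 1 = 1 is not required but follows from
   phi being multiplicative and nonzero. *)
Definition spectrum : set (Au -> R[i]) :=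
  [set phi | [/\ scalar phi, {morph phi : f g / f * g} & exists f, phi f != 0]].

Definition fiber (z : bidual V) : set (Au -> R[i]) :=
  [set phi | spectrum phi /\ forall F : dual V, phi (Au_of_dual F) = z F].

End BallAlgebra.

Arguments unit_sphere {R} V _.
Arguments unit_ball {R} V _.
Arguments spectrum {R} V _.

(* Main.v *)
Require Import Defs.
From HB Require Import structures.
From mathcomp Require Import all_boot all_order all_algebra.
From mathcomp Require Import all_classical all_reals all_analysis.
From mathcomp Require Import complex.
From mathcomp Require Import ring lra.

(** Take a bounded net in the ball that converges weak-star to [z]; evaluation
    along an ultrafilter finer than it is a homomorphism in the fiber over [z].
    Since the trace on the ball of a weak-star neighbourhood of [z] is convex,
    the real parts of a function on it form an interval.  So it is enough to find
    one function [g] of the algebra that has two distinct cluster values at [z]: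
    all intermediate real parts are then cluster values too, and they are taken
    by different homomorphisms ([fiber_Re_value], [fiber_continuum]).

    The bidual splits as in the theorem of Yosida and Hewitt ([yosida_hewitt]):
    [z = x + mu], where [x] is a summable sequence and [mu] is a finitely
    additive complex measure on the integers that vanishes on finite sets, with
    the norm of [x] plus the total variation of [mu] at most the norm of [z].
    If [mu] were zero, [z] would be a unit vector of the space itself.  A basic
    weak-star neighbourhood of [z] only looks at a finite coloring of the
    integers ([dual_coloring], [simple_approx]), and it contains
    [x + sum_t mu(A_t) e_(n t)] for the color classes [A_t] and any choice of
    points [n t] in the classes that are not null.  Such classes are infinite, so
    these points can be taken in any order and arbitrarily far out
    ([represents_ordered], [represents_far]).  The norm inequality keeps these
    vectors in the closed unit ball.

    The function [g] is a quadratic form in [y - x], so that only the finite sum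
    matters.  If two disjoint sets [A] and [A'] have nonzero mass, let the form
    add up the products of a coordinate in [A'] with the earlier coordinates in
    [A]: it takes the value [mu(A) mu(A')] when the points in [A] come first,
    and 0 when those in [A'] do ([fiber_two_pieces]).  Otherwise [mu] is a
    nonzero multiple [m] of an ultrafilter, and the sum of the squares of the
    coordinates is [m ^ 2] or [m ^ 2 / 2], depending on whether the mass is
    put on one point or split evenly between two ([fiber_one_atom]). *)

Set Implicit Arguments.
Unset Strict Implicit.
Unset Printing Implicit Defensive.

Import Order.TTheory GRing.Theory Num.Theory.
Import numFieldNormedType.Exports.

Local Open Scope classical_set_scope.
Local Open Scope card_scope.
Local Open Scope ring_scope.
Local Open Scope complex_scope.

(** * Complex scalars *)

Section ComplexNorm.
Context {R : realType}.
Local Notation C := (Cplx R).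
Implicit Types (a b : C).

Lemma ReD a b : complex.Re (a + b) = complex.Re a + complex.Re b.
Proof. by case: a b => [? ?] []. Qed.

Lemma ImD a b : complex.Im (a + b) = complex.Im a + complex.Im b.
Proof. by case: a b => [? ?] []. Qed.

Lemma ReB a b : complex.Re (a - b) = complex.Re a - complex.Re b.
Proof. by case: a b => [? ?] []. Qed.

Lemma ImB a b : complex.Im (a - b) = complex.Im a - complex.Im b.
Proof. by case: a b => [? ?] []. Qed.

Lemma ReM a b : complex.Re (a * b) =
  complex.Re a * complex.Re b - complex.Im a * complex.Im b.
Proof. by case: a b => [? ?] []. Qed.

Lemma ImM a b : complex.Im (a * b) =
  complex.Re a * complex.Im b + complex.Im a * complex.Re b.
Proof. by case: a b => [? ?] []. Qed.

Lemma Re_sum (I : Type) (s : seq I) (P : pred I) (F : I -> C) :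
  complex.Re (\sum_(i <- s | P i) F i) = \sum_(i <- s | P i) complex.Re (F i).
Proof. by elim/big_rec2: _ => // i x y _ <-; rewrite ReD. Qed.

Lemma Im_sum (I : Type) (s : seq I) (P : pred I) (F : I -> C) :
  complex.Im (\sum_(i <- s | P i) F i) = \sum_(i <- s | P i) complex.Im (F i).
Proof. by elim/big_rec2: _ => // i x y _ <-; rewrite ImD. Qed.

Lemma rnormM a b : rnorm (a * b) = rnorm a * rnorm b.
Proof. exact: rnormZ. Qed.

Lemma rnormN (V : normedModType R[i]) (x : V) : rnorm (- x) = rnorm x.
Proof. by rewrite /rnorm normrN. Qed.

Lemma rnormBC (V : normedModType R[i]) (x y : V) : rnorm (x - y) = rnorm (y - x).
Proof. by rewrite /rnorm distrC. Qed.

Lemma rnormB (V : normedModType R[i]) (x y : V) :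
  rnorm (x - y) <= rnorm x + rnorm y.
Proof. by rewrite -(rnormN y) rnormD. Qed.

Lemma rnorm_sum (V : normedModType R[i]) (I : Type) (s : seq I) (P : pred I)
    (F : I -> V) :
  rnorm (\sum_(i <- s | P i) F i) <= \sum_(i <- s | P i) rnorm (F i).
Proof.
elim/big_rec2: _ => [|i x y _ le_xy]; first by rewrite rnorm0.
by rewrite (le_trans (rnormD _ _))// lerD2l.
Qed.

Lemma rnormR (r : R) : rnorm (r%:C : C) = `|r|.
Proof. by rewrite /rnorm normc_def/= expr0n/= addr0 sqrtr_sqr. Qed.

Lemma rnorm1 : rnorm (1 : C) = 1.
Proof. by rewrite /rnorm normr1. Qed.

Lemma Re_le_rnorm a : `|complex.Re a| <= rnorm a.
Proof. by rewrite -lecR rnormE normc_ge_Re. Qed.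

Lemma Im_le_rnorm a : `|complex.Im a| <= rnorm a.
Proof.
rewrite /rnorm normc_def/= -sqrtr_sqr ler_wsqrtr// lerDr sqr_ge0//.
Qed.

Lemma rnorm_le_ReIm a : rnorm a <= `|complex.Re a| + `|complex.Im a|.
Proof.
rewrite {1}[a : R[i]]complexE (le_trans (rnormD _ _))// rnormR lerD2l.
by rewrite rnormM rnormR /rnorm normc_def/= expr0n/= add0r expr1n sqrtr1 mul1r.
Qed.

(** Coefficients chosen this way make the terms of a sum add up without
    cancellation. *)
Lemma norming_scalar a :
  exists2 s : C, rnorm s <= 1 & s * a = (rnorm a)%:C :> R[i].
Proof.
have [->|a0] := eqVneq a 0.
  by exists 0; rewrite ?rnorm0 ?mul0r.
have n0 : `|a : R[i]| != 0 by rewrite normr_eq0.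
exists ((`|a : R[i]| / a) : R[i]); last first.
  by rewrite rnormE -[LHS]/((`|a : R[i]| / a) * (a : R[i])) divfK.
rewrite -lecR rnormE -[`|_|]/(`|(`|a : R[i]| / a) : R[i]|).
by rewrite normrM normfV normr_id divff.
Qed.

End ComplexNorm.

(** * Limits along an ultrafilter *)

Section UltraLimit.
Context {R : realType} {T : Type}.
Variable U : set_system T.
Context {UU : UltraFilter U}.
Local Notation C := (Cplx R).

Lemma ultra_is_cvg (f : T -> R) (M : R) : (forall x, `|f x| <= M) -> cvg (f @ U).
Proof.
move=> fM.
have fUM : (f @ U) [set` `[- M, M]].
  by rewrite /= nbhs_filterE; apply: filterE => x; rewrite /= in_itv/= -ler_norml.
have [p [_ clp]] := @segment_compact R (- M) M (f @ U) _ fUM.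
apply/cvg_ex; exists p => N Np.
have [//|UN] := in_ultra_setVsetC (f @^-1` N) UU.
by have [y [/= nNy Ny]] := clp (~` N) N UN Np.
Qed.

Definition ulim (h : T -> C) : C :=
  Complex (lim (@complex.Re R \o h @ U)) (lim (@complex.Im R \o h @ U)).

Definition bounded_fam (h : T -> C) := exists M : R, forall x, rnorm (h x) <= M.

Lemma ulim_Re (h : T -> C) : bounded_fam h ->
  @complex.Re R \o h @ U --> complex.Re (ulim h).
Proof.
move=> [M hM]; apply: (@ultra_is_cvg _ M) => x.
exact: le_trans (Re_le_rnorm _) (hM x).
Qed.

Lemma ulim_Im (h : T -> C) : bounded_fam h ->
  @complex.Im R \o h @ U --> complex.Im (ulim h).
Proof.
move=> [M hM]; apply: (@ultra_is_cvg _ M) => x.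
exact: le_trans (Im_le_rnorm _) (hM x).
Qed.

Lemma ulim_unique (h : T -> C) (l : C) :
  @complex.Re R \o h @ U --> complex.Re l ->
  @complex.Im R \o h @ U --> complex.Im l -> ulim h = l.
Proof.
move=> hr hi; rewrite /ulim (cvg_lim _ hr)// (cvg_lim _ hi)//.
by case: (l).
Qed.

Lemma ulimP (h : T -> C) (l : C) :
  (forall e : R, 0 < e -> U [set x | rnorm (h x - l) < e]) -> ulim h = l.
Proof.
move=> hl; apply: ulim_unique; apply/cvgrPdist_lt => e e0;
  apply: filterS (hl e e0) => x /=; apply: le_lt_trans.
  by rewrite distrC -ReB Re_le_rnorm.
by rewrite distrC -ImB Im_le_rnorm.
Qed.

Lemma ulim_const (l : C) : ulim (fun=> l) = l.
Proof. by apply: ulimP => e e0; apply: filterE => x /=; rewrite subrr rnorm0. Qed.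

Lemma ulimD (f g : T -> C) : bounded_fam f -> bounded_fam g ->
  ulim (f \+ g) = ulim f + ulim g.
Proof.
move=> bf bg; apply: ulim_unique.
  rewrite ReD (_ : _ \o _ = (@complex.Re R \o f) \+ (@complex.Re R \o g)).
    by apply: cvgD; exact: ulim_Re.
  by apply/funext => x /=; rewrite ReD.
rewrite ImD (_ : _ \o _ = (@complex.Im R \o f) \+ (@complex.Im R \o g)).
  by apply: cvgD; exact: ulim_Im.
by apply/funext => x /=; rewrite ImD.
Qed.

Lemma ulimM (f g : T -> C) : bounded_fam f -> bounded_fam g ->
  ulim (f \* g) = ulim f * ulim g.
Proof.
move=> bf bg; apply: ulim_unique.
  rewrite ReM (_ : _ \o _ = ((@complex.Re R \o f) \* (@complex.Re R \o g))
    \- ((@complex.Im R \o f) \* (@complex.Im R \o g))).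
    by apply: cvgB; apply: cvgM; do ?[exact: ulim_Re|exact: ulim_Im].
  by apply/funext => x /=; rewrite ReM.
rewrite ImM (_ : _ \o _ = ((@complex.Re R \o f) \* (@complex.Im R \o g))
    \+ ((@complex.Im R \o f) \* (@complex.Re R \o g))).
  by apply: cvgD; apply: cvgM; do ?[exact: ulim_Re|exact: ulim_Im].
by apply/funext => x /=; rewrite ImM.
Qed.

End UltraLimit.

(** * Homomorphisms carried by ultrafilters on the ball *)

Section UltraFiber.
Context {R : realType} {V : normedModType R[i]}.
Local Notation C := (Cplx R).

Lemma Au_bounded (f : Au V) : bounded_fam (Au_val f).
Proof.
case: f => f fA; have /set_mem[_ fu] := fA.
exact: unit_ball_bounded fu.
Qed.

Lemma Au_uc (f : Au V) (e : R) : 0 < e -> exists2 d : R, 0 < d &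
  forall x y : unit_ball V, rnorm (val x - val y) < d -> rnorm (f x - f y) < e.
Proof.
move=> e0; case: f => f fA; have /set_mem[_ /unit_ball_ucP fu] := fA.
exact: fu.
Qed.

(** Limits along an ultrafilter exist for all bounded functions and respect
    products, so weak-star convergence to [z] is all that membership in the
    fiber asks of the ultrafilter. *)
Lemma ultra_fiber (U : set_system (unit_ball V)) (UU : UltraFilter U)
    (z : bidual V) :
  (forall (F : dual V) (e : R), 0 < e ->
     U [set y : unit_ball V | rnorm (F (val y) - z F) < e]) ->
  fiber z (fun f : Au V => ulim U (Au_val f)).
Proof.
move=> Uz; split; last first.
  by move=> F; apply: ulimP => e e0; exact: Uz.
split.
- move=> a f g; rewrite -[RHS]/(a * ulim U (Au_val f) + ulim U (Au_val g)).
  rewrite -[a in RHS](ulim_const (U := U)) -ulimM; [|by exists (rnorm (a : C))|exact: Au_bounded].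
  rewrite -ulimD//; last exact: Au_bounded.
  have [M fM] := Au_bounded f.
  exists (rnorm (a : C) * M) => x /=.
  by rewrite rnormM ler_wpM2l ?rnorm_ge0.
- by move=> f g; rewrite -ulimM//; exact: Au_bounded.
- exists 1; rewrite (_ : ulim _ _ = 1) ?oner_neq0//.
  exact: ulim_const.
Qed.

End UltraFiber.

(** * Fibers over points with two cluster values *)

Section ClusterValues.
Context {R : realType} {V : normedModType R[i]}.
Local Notation C := (Cplx R).

Definition cluster_value (z : bidual V) (g : Au V) (v : C) :=
  forall (s : seq (dual V)) (e : R), 0 < e -> exists y : unit_ball V,
    (forall F, F \in s -> rnorm (F (val y) - z F) < e) /\ rnorm (g y - v) < e.

Lemma unit_ball_segment (y0 y1 : unit_ball V) (s : R) : 0 <= s <= 1 ->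
  (1 - s)%:C *: val y0 + s%:C *: val y1 \in unit_ball V.
Proof.
move=> /andP[s0 s1]; apply/mem_set; rewrite /unit_ball/=.
rewrite (le_lt_trans (rnormD _ _))// !rnormZ !rnormR !ger0_norm ?subr_ge0//.
have := unit_ball_val y0; have := unit_ball_val y1; rewrite /unit_ball/=.
set a := rnorm (val y1); set b := rnorm (val y0) => a1 b1.
have [->|s_neq0] := eqVneq s 0; first by rewrite subr0 mul1r mul0r addr0.
rewrite (@le_lt_trans _ _ ((1 - s) + s * a))//.
  by rewrite lerD2r ler_piMr ?subr_ge0// ltW.
by rewrite -ltrBrDl opprB addrCA subrr addr0 gtr_pMr// lt_neqAle eq_sym s_neq0.
Qed.

Lemma Au_segment_IVT (g : Au V) (y0 y1 : unit_ball V) (t : R) :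
  complex.Re (g y0) <= t <= complex.Re (g y1) ->
  exists s : R, 0 <= s <= 1 /\ exists y : unit_ball V,
    val y = (1 - s)%:C *: val y0 + s%:C *: val y1 /\ complex.Re (g y) = t.
Proof.
move=> gt.
(* Clamping the parameter makes the path total on the line, so that continuity
   needs no restriction to the interval. *)
pose k (s : R) := Num.max 0 (Num.min 1 s).
have kI s : 0 <= k s <= 1.
  by rewrite /k le_max lexx/= ge_max ler01/= ge_min lexx.
have kid s : 0 <= s <= 1 -> k s = s.
  by move=> /andP[s0 s1]; rewrite /k (min_r s1) max_r.
have kL s s' : `|k s - k s'| <= `|s - s'|.
  rewrite /k !maxEle !minEle.
  by do ?case: ifPn; rewrite -?ltNge => *; rewrite ler_norml; apply/andP; split;
    have := ler_norm (s - s'); have := ler_norm (s' - s); rewrite (distrC s'); lra.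
pose p s : unit_ball V := SigSub (unit_ball_segment y0 y1 (kI s)).
have ch : continuous (fun s => complex.Re (g (p s))).
  move=> s; apply/cvgrPdist_lt => e e0.
  have [d d0 gd] := Au_uc g e0.
  have d20 : 0 < d / 2 by rewrite divr_gt0.
  have := nbhsx_ballx s _ d20; apply: filterS => s'.
  rewrite -ball_normE/= => ss'; rewrite -ReB (le_lt_trans (Re_le_rnorm _))//; apply: gd => /=.
  rewrite (_ : _ - _ = (k s' - k s)%:C *: (val y0 - val y1)); last first.
    rewrite opprD addrACA -!scalerBl scalerBr -scaleNr -!rmorphB/= -rmorphN/=.
    by congr (_%:C *: _ + _%:C *: _); ring.
  rewrite rnormZ rnormR (@le_lt_trans _ _ (`|s' - s| * 2))//.
    rewrite ler_pM ?rnorm_ge0// (le_trans (rnormB _ _))//.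
    by rewrite -[2]/(1 + 1) lerD// ltW// unit_ball_val.
  by rewrite -ltr_pdivlMr// distrC.
have [||c] := @IVT R (fun s => complex.Re (g (p s))) 0 1 t ler01.
- exact: continuous_subspaceT.
- have -> : p 0 = y0.
    by apply: val_inj; rewrite /= kid ?lexx ?ler01// subr0 scale1r scale0r addr0.
  have -> : p 1 = y1.
    by apply: val_inj; rewrite /= kid ?lexx ?ler01// subrr scale1r scale0r add0r.
  by move: gt => /andP[g0 g1]; rewrite ge_min g0/= le_max g1 orbT.
rewrite in_itv/= => c01 gc; exists c; split=> //; exists (p c); split=> //.
by rewrite /= kid.
Qed.

(** The trace on the ball of a weak-star neighbourhood of [z] is convex, so
    real parts of [g] on it fill the interval between any two of them; the
    points where a prescribed intermediate value is taken then form a filter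
    converging to [z]. *)
Lemma fiber_Re_value (z : bidual V) (g : Au V) (t : R) :
  cluster_value z g 0 -> cluster_value z g 1 -> 0 < t < 1 ->
  exists2 phi, fiber z phi & complex.Re (phi g) = t.
Proof.
move=> g0 g1 /andP[t0 t1].
pose D := [set se : seq (dual V) * R | 0 < se.2].
pose B (se : seq (dual V) * R) := [set y : unit_ball V |
  (forall F, F \in se.1 -> rnorm (F (val y) - z F) < se.2) /\
  complex.Re (g y) = t].
have FB : ProperFilter (filter_from D B).
  apply: filter_from_proper.
    apply: filter_from_filter; first by exists ([::], 1) => /=; rewrite /D/= ltr01.
    move=> [s1 e1] [s2 e2] /= e10 e20; exists (s1 ++ s2, Num.min e1 e2).
      by rewrite /D/= lt_min e10.
    move=> y [/= yF gy]; split; split=> //= F Fs.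
      by have := yF F; rewrite mem_cat Fs lt_min => /(_ isT)/andP[].
    by have := yF F; rewrite mem_cat Fs orbT lt_min => /(_ isT)/andP[].
  move=> [s e] /= e0.
  pose e' := Num.min e (Num.min t (1 - t)).
  have e'0 : 0 < e' by rewrite !lt_min e0 t0 subr_gt0.
  have [y0 [y0F gy0]] := g0 s e' e'0; have [y1 [y1F gy1]] := g1 s e' e'0.
  have [|c [/andP[c0 c1] [y [yE gy]]]] := @Au_segment_IVT g y0 y1 t.
    apply/andP; split.
      rewrite subr0 in gy0.
      rewrite (le_trans (ler_norm _))// (le_trans (Re_le_rnorm _))//.
      by rewrite ltW// (lt_le_trans gy0)// !ge_min lexx orbT.
    have : 1 - complex.Re (g y1) < 1 - t.
      rewrite -[1]/(complex.Re (1 : C)) -ReB (le_lt_trans (ler_norm _))//.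
      rewrite (le_lt_trans (Re_le_rnorm _))// rnormBC (lt_le_trans gy1)//.
      by rewrite !ge_min lexx !orbT.
    by rewrite ltrD2l ltrN2 => /ltW.
  exists y; split=> //= F Fs; apply: (@lt_le_trans _ _ e'); last first.
    by rewrite ge_min lexx.
  have -> : F (val y) - z F =
      (1 - c)%:C *: (F (val y0) - z F) + c%:C *: (F (val y1) - z F).
    rewrite yE linearD !linearZ/= -!/(_ *: _) !scalerBr addrACA -opprD -scalerDl.
    by rewrite -rmorphD/= subrK scale1r.
  rewrite (le_lt_trans (rnormD _ _))// !rnormZ !rnormR !ger0_norm ?subr_ge0//.
  have := y0F F Fs; have := y1F F Fs.
  set a := rnorm _; set b := rnorm _ => ae be.
  have [->|c_neq0] := eqVneq c 0; first by rewrite subr0 mul1r mul0r addr0.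
  have c_gt0 : 0 < c by rewrite lt_neqAle eq_sym c_neq0.
  have -> : e' = (1 - c) * e' + c * e' by ring.
  by rewrite ler_ltD// ?ltr_pM2l// ler_wpM2l ?subr_ge0// ltW.
have [U [UU sFU]] := ultraFilterLemma FB.
exists (fun f : Au V => ulim U (Au_val f)).
  apply: ultra_fiber => F e e0; apply: sFU; exists ([:: F], e) => // y [/= + _].
  by apply; rewrite mem_head.
apply: cvg_lim => //; apply/cvgrPdist_lt => e e0; apply: sFU; exists ([::], 1); first exact: ltr01.
by move=> y [_ /= ->]; rewrite subrr normr0.
Qed.

(** After an affine change of [g] the two cluster values are 0 and 1; the real
    parts in between are then attained by pairwise distinct elements of the
    fiber. *)
Lemma fiber_continuum (z : bidual V) (g : Au V) (v0 v1 : C) :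
  v0 != v1 -> cluster_value z g v0 -> cluster_value z g v1 ->
  [set: R] #<= fiber z.
Proof.
move=> v01 g0 g1.
pose k : R[i] := (v1 - v0)^-1.
have v10 : v1 - v0 != 0 by rewrite subr_eq0 eq_sym.
have k0 : 0 < rnorm (k : C).
  rewrite lt_neqAle rnorm_ge0 andbT eq_sym.
  by apply: contra_neq v10 => /rnorm0_eq0/eqP; rewrite invr_eq0 => /eqP.
pose h : Au V := k *: (g - (v0 : R[i]) *: 1).
have hE y : h y = k * (g y - v0) :> C.
  by rewrite -[LHS]/(k * (g y - v0 * 1)) mulr1.
have hv v : cluster_value z g v -> cluster_value z h (k * (v - v0)).
  move=> gv s e e0.
  pose e' := Num.min e (e / rnorm (k : C)).
  have e'0 : 0 < e' by rewrite lt_min e0 divr_gt0.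
  have [y [yF gy]] := gv s e' e'0; exists y; split.
    by move=> F Fs; rewrite (lt_le_trans (yF F Fs))// ge_min lexx.
  rewrite hE -mulrBr opprB addrA subrK rnormM mulrC -ltr_pdivlMr//.
  by rewrite (lt_le_trans gy)// ge_min lexx orbT.
have h0 : cluster_value z h 0 by rewrite -(mulr0 k) -(subrr v0); exact: hv.
have h1 : cluster_value z h 1 by rewrite -(mulVf v10); exact: hv.
(* An injection of the line into the open unit interval. *)
pose sg (x : R) : R := expR (- expR x).
have sgI x : 0 < sg x < 1.
  by rewrite expR_gt0/= -expR0 ltr_expR oppr_lt0 expR_gt0.
pose P x phi := fiber z phi /\ complex.Re (phi h : C) = sg x.
have /choice[phi phiP] : forall x, exists phi, P x phi.
  by move=> x; have [phi fphi phiE] := fiber_Re_value h0 h1 (sgI x); exists phi.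
have : $|{injfun [set: R] >-> fiber z}|.
  apply/injfunPex; exists phi; first by move=> x _; exact: (phiP x).1.
  move=> x y _ _ /(congr1 (fun f : Au V -> R[i] => complex.Re (f h))).
  by rewrite (phiP x).2 (phiP y).2 => /expR_inj/oppr_inj/expR_inj.
by move=> [f]; exact: inj_card_le f.
Qed.

End ClusterValues.

(** * Translated quadratic forms *)

Section Quadratic.
Context {R : realType} {V : normedModType R[i]}.
Local Notation C := (Cplx R).

Record bounded_bilinear (B : V -> V -> C) (K : R) : Prop := BoundedBilinear {
  bilinear_l : forall y, linear (B^~ y);
  bilinear_r : forall x, linear (B x);
  bilinear_const_ge0 : 0 <= K;
  bilinear_bound : forall x y, rnorm (B x y) <= K * (rnorm x * rnorm y) }.

Variables (B : V -> V -> C) (K : R).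
Hypothesis HB : bounded_bilinear B K.

Lemma bilDl x y u : B (x + y) u = B x u + B y u.
Proof. by have := bilinear_l HB u 1 x y; rewrite !scale1r. Qed.

Lemma bilDr u x y : B u (x + y) = B u x + B u y.
Proof. by have := bilinear_r HB u 1 x y; rewrite !scale1r. Qed.

Lemma bil0l u : B 0 u = 0.
Proof. by apply: (addIr (B 0 u)); rewrite -bilDl !add0r. Qed.

Lemma bil0r u : B u 0 = 0.
Proof. by apply: (addIr (B u 0)); rewrite -bilDr !add0r. Qed.

Lemma bilZl (a : C) x u : B (a *: x) u = a * B x u.
Proof. by have := bilinear_l HB u a x 0; rewrite !addr0 bil0l addr0. Qed.

Lemma bilZr (a : C) x u : B u (a *: x) = a * B u x.
Proof. by have := bilinear_r HB u a x 0; rewrite !addr0 bil0r addr0. Qed.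

Lemma bilBl x y u : B (x - y) u = B x u - B y u.
Proof. by rewrite bilDl -scaleN1r bilZl mulN1r. Qed.

Lemma bilBr u x y : B u (x - y) = B u x - B u y.
Proof. by rewrite bilDr -scaleN1r bilZr mulN1r. Qed.

Lemma bil_suml (I : Type) (s : seq I) (P : pred I) (F : I -> V) u :
  B (\sum_(i <- s | P i) F i) u = \sum_(i <- s | P i) B (F i) u.
Proof. exact: (big_morph _ (fun x y => bilDl x y u) (bil0l u)). Qed.

Lemma bil_sumr (I : Type) (s : seq I) (P : pred I) (F : I -> V) u :
  B u (\sum_(i <- s | P i) F i) = \sum_(i <- s | P i) B u (F i).
Proof. exact: (big_morph _ (bilDr u) (bil0r u)). Qed.

Lemma quad_lipschitz u v :
  rnorm (B u u - B v v) <= K * ((rnorm u + rnorm v) * rnorm (u - v)).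
Proof.
have -> : B u u - B v v = B u (u - v) + B (u - v) v.
  by rewrite bilBr bilBl addrA subrK.
rewrite mulrDl mulrDr (le_trans (rnormD _ _))// lerD//.
  exact: bilinear_bound.
by rewrite (mulrC (rnorm v)); exact: bilinear_bound.
Qed.

Lemma quad_differentiable (x u : V) :
  differentiable (fun y => B (y - x) (y - x)) u.
Proof.
pose L h := B (u - x) h + B h (u - x).
have linL : linear L.
  move=> a h k; rewrite /L (bilDr (u - x)) (bilDl (a *: h)) bilZr bilZl addrACA.
  by rewrite -[a *: _]/(a * _) mulrDr.
pose Lin := GRing.isLinear.Build R[i] V C *:%R L linL.
pose F : {linear V -> C} := HB.pack L Lin.
have K0 := bilinear_const_ge0 HB.
apply/frechetP; exists F; split.
  apply: (@bounded_linear_continuous R[i] V C F); apply/bounded_funP => r.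
  exists ((K * (rnorm (u - x) + rnorm (u - x)))%:C * r) => h hr.
  rewrite (@le_trans _ _ ((K * (rnorm (u - x) + rnorm (u - x)))%:C * `|h|))//.
    rewrite -!rnormE -rmorphM lecR (le_trans (rnormD _ _))//.
    rewrite mulrDr mulrDl lerD//; first by rewrite -mulrA (bilinear_bound HB).
    by rewrite -mulrA (mulrC (rnorm (u - x))) (bilinear_bound HB).
  by rewrite ler_wpM2l// lecR mulr_ge0// addr_ge0 ?rnorm_ge0.
move=> e e0.
have eE : e = (complex.Re e)%:C by rewrite RRe_real// gtr0_real.
have re0 : 0 < complex.Re e by rewrite -ltcR -eE.
have d0 : 0 < (complex.Re e / (K + 1))%:C :> R[i].
  by rewrite ltcR divr_gt0// ltr_wpDl.
have := nbhsx_ballx (0 : V) _ d0; apply: filterS => h.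
rewrite -ball_normE/= sub0r normrN -rnormE ltcR ltr_pdivlMr ?ltr_wpDl// => he.
rewrite -[X in `|_ - X|]/(B (u - x) h + B h (u - x)).
have -> : B (h + u - x) (h + u - x) - B (u - x) (u - x)
    - (B (u - x) h + B h (u - x)) = B h h.
  rewrite -(addrA h) (bilDl h) !(bilDr _ h); ring.
rewrite -rnormE eE -rmorphM lecR (le_trans (bilinear_bound HB _ _))//.
rewrite mulrA ler_wpM2r ?rnorm_ge0// (le_trans _ (ltW he))// mulrC.
by rewrite ler_wpM2l ?rnorm_ge0// lerDl.
Qed.

Lemma quad_Au_subproof (x : V) :
  (fun y : unit_ball V => B (val y - x) (val y - x)) \in @Au_fun R V.
Proof.
apply/mem_set; split.
  apply: (@holomorphic_ext _ _ (fun y => B (y - x) (y - x))).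
    move=> y /set_mem yB.
    by rewrite -[y in RHS]/(val (SigSub (mem_set yB) : unit_ball V)) valL_unit_ball.
  by move=> y _; exact: quad_differentiable.
apply/unit_ball_ucP => e e0.
have K0 := bilinear_const_ge0 HB.
pose M := K * (2 * (1 + rnorm x)) + 1.
have M0 : 0 < M.
  by rewrite ltr_wpDl// mulr_ge0// mulr_ge0// addr_ge0// rnorm_ge0.
exists (e / M) => [|u v]; first by rewrite divr_gt0.
rewrite ltr_pdivlMr// => uv; apply: le_lt_trans uv.
rewrite (le_trans (quad_lipschitz _ _))//.
rewrite (_ : val u - x - (val v - x) = val u - val v); last first.
  by rewrite opprB addrA subrK.
rewrite mulrA mulrC ler_wpM2l ?rnorm_ge0//.
rewrite (@le_trans _ _ (K * (2 * (1 + rnorm x))))// ?lerDl//.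
have H (w : unit_ball V) : rnorm (val w - x) <= 1 + rnorm x.
  by rewrite (le_trans (rnormB _ _))// lerD2r ltW// unit_ball_val.
by rewrite ler_wpM2l// mulr_natl mulr2n lerD.
Qed.

(** The translation by [x] makes the value at [x + w] depend on [w] only, so
    that the part of a point of the bidual lying in the space itself drops
    out of the computation. *)
Definition quad_Au (x : V) : Au V := MkAu (quad_Au_subproof x).

(** Approximants in the closed ball suffice: shrinking them slightly
    brings them inside the open ball and moves all values by little. *)
Lemma quad_cluster (z : bidual V) (x : V) (v : C) :
  (forall (s : seq (dual V)) (e : R), 0 < e -> exists y : V, [/\ rnorm y <= 1,
    forall F, F \in s -> rnorm (F y - z F) < e & B (y - x) (y - x) = v]) ->
  cluster_value z (quad_Au x) v.
Proof.
move=> zv s e e0.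
have e20 : 0 < e / 2 by rewrite divr_gt0.
have [y [y1 yF yv]] := zv s _ e20.
have K0 := bilinear_const_ge0 HB.
(* M bounds all the Lipschitz constants involved. *)
pose M := K * (2 * (1 + rnorm x)) + \sum_(F <- s) rnorm F + 1.
have S0 : 0 <= \sum_(F <- s) rnorm F by rewrite sumr_ge0// => F _; rewrite rnorm_ge0.
have KM0 : 0 <= K * (2 * (1 + rnorm x)).
  by rewrite mulr_ge0// mulr_ge0// addr_ge0// rnorm_ge0.
have M0 : 0 < M by rewrite ltr_wpDl// addr_ge0.
pose d := Num.min (1 / 2) (e / 2 / M).
have d0 : 0 < d by rewrite lt_min divr_gt0// divr_gt0.
have d1 : d < 1 by rewrite gt_min; apply/orP; left; lra.
have dM : d * M <= e / 2 by rewrite -ler_pdivlMr// ge_min lexx orbT.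
pose w := (1 - d)%:C *: y.
have wy : rnorm (w - y) <= d.
  have -> : w - y = (- d)%:C *: y.
    by rewrite /w -[X in _ - X]scale1r -scalerBl rmorphB rmorph1 addrAC subrr add0r rmorphN.
  by rewrite rnormZ rnormR normrN gtr0_norm// ler_piMr// ltW.
have w1 : rnorm w < 1.
  rewrite /w rnormZ rnormR ger0_norm ?subr_ge0 ?(ltW d1)//.
  by rewrite (@le_lt_trans _ _ (1 - d))// ?gtrBl// ler_piMr// subr_ge0 ltW.
exists (SigSub (mem_set w1 : w \in unit_ball V)); split.
  move=> F Fs /=; rewrite (_ : _ - _ = F (w - y) + (F y - z F)); last first.
    by rewrite linearB addrA subrK.
  rewrite (le_lt_trans (rnormD _ _))// [e]splitr ler_ltD// ?yF//.
  rewrite (le_trans _ dM)// (le_trans (dual_le _ _))// mulrC ler_pM ?rnorm_ge0//.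
  rewrite /M (big_rem F)//= addrA addrAC (addrC _ (rnorm F)) -!addrA lerDl.
  by rewrite !addr_ge0// sumr_ge0// => G _; rewrite rnorm_ge0.
rewrite -[X in X - v]/(B (w - x) (w - x)) -yv.
rewrite (le_lt_trans (quad_lipschitz _ _))//.
rewrite (_ : w - x - (y - x) = w - y); last by rewrite opprB addrA subrK.
have -> : K * ((rnorm (w - x) + rnorm (y - x)) * rnorm (w - y)) =
  rnorm (w - y) * (K * (rnorm (w - x) + rnorm (y - x))) by ring.
rewrite (@le_lt_trans _ _ (d * M))//; last first.
  by rewrite (le_lt_trans dM)// ltr_pdivrMr// ltr_pMr//; lra.
rewrite ler_pM// ?rnorm_ge0// ?mulr_ge0// ?addr_ge0 ?rnorm_ge0//.
have H u : rnorm u <= 1 -> rnorm (u - x) <= 1 + rnorm x.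
  by move=> u1; rewrite (le_trans (rnormB _ _))// lerD2r.
rewrite (@le_trans _ _ (K * (2 * (1 + rnorm x))))//.
  by rewrite ler_wpM2l// mulr_natl mulr2n lerD// H// ltW.
by rewrite /M -addrA lerDl addr_ge0.
Qed.

End Quadratic.

(** * Absolutely summable sequences *)

Section EllOneSums.
Context {R : realType}.
Local Notation C := (Cplx R).
Local Notation l1 := (l1 R).
Implicit Types (x y : l1) (u : nat -> C).

Lemma rnorm_series_homo u :
  {homo series (fun n => rnorm (u n)) : m n / (m <= n)%N >-> m <= n}.
Proof.
apply/nondecreasing_seqP => n.
by rewrite /series/= big_nat_recr//= lerDl rnorm_ge0.
Qed.

Lemma l1_seq_of_bounded u (M : R) :
  (forall N, \sum_(n < N) rnorm (u n) <= M) -> u \in @l1_seq R.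
Proof.
move=> uM; apply/mem_set => /=; apply: nondecreasing_is_cvgn.
  exact: rnorm_series_homo.
by exists M => _ [N _ <-]; rewrite /series/= big_mkord.
Qed.

Lemma l1_partial_le x N : \sum_(n < N) rnorm (x n) <= rnorm x.
Proof.
have := nondecreasing_cvgn_le (@rnorm_series_homo x) (@l1_cvg R x) N.
by rewrite /series/= big_mkord.
Qed.

Lemma l1_norm_le x (M : R) :
  (forall N, \sum_(n < N) rnorm (x n) <= M) -> rnorm x <= M.
Proof.
move=> xM; rewrite l1_normE; apply: limr_le; first exact: l1_cvg.
by apply: nearW => N; rewrite /series/= big_mkord.
Qed.

Lemma l1_partial_gt x (e : R) : 0 < e ->
  exists N, rnorm x - e < \sum_(n < N) rnorm (x n).
Proof.
move=> e0; apply/not_existsP => H.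
suff : rnorm x <= rnorm x - e by rewrite lerBrDr gerDl leNgt e0.
apply: l1_norm_le => N; have /negP := H N.
by rewrite -leNgt.
Qed.

(** Real and imaginary parts of an absolutely convergent complex series
    converge by completeness of the reals. *)
Lemma l1_seq_cvg u : u \in @l1_seq R ->
  exists l : C, series u @ \oo --> (l : C).
Proof.
move=> /set_mem/= cu.
have cre : cvgn (series (fun n => complex.Re (u n))).
  apply: normed_cvg; refine (series_le_cvg _ _ _ cu) => n /=.
  - exact: normr_ge0.
  - exact: rnorm_ge0.
  - exact: Re_le_rnorm.
have cim : cvgn (series (fun n => complex.Im (u n))).
  apply: normed_cvg; refine (series_le_cvg _ _ _ cu) => n /=.
  - exact: normr_ge0.
  - exact: rnorm_ge0.
  - exact: Im_le_rnorm.
exists (Complex (limn (series (fun n => complex.Re (u n))))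
                (limn (series (fun n => complex.Im (u n))))).
apply/cvgrPdist_lt => e e0.
have eE : e = (complex.Re e)%:C by rewrite RRe_real// gtr0_real.
have e20 : 0 < complex.Re e / 2 by rewrite divr_gt0// -ltcR -eE.
near=> n; rewrite -rnormE eE ltcR (le_lt_trans (rnorm_le_ReIm _))//.
rewrite [ltRHS]splitr ltrD//.
  rewrite ReB Re_sum/=; near: n.
  by move/cvgrPdist_lt: cre => /(_ _ e20).
rewrite ImB Im_sum/=; near: n.
by move/cvgrPdist_lt: cim => /(_ _ e20).
Unshelve. all: by end_near. Qed.

Definition csum u : C := limn (series u : nat -> C).

Lemma csum_cvg u : u \in @l1_seq R -> series u @ \oo --> csum u.
Proof. by move=> /l1_seq_cvg/cvg_ex. Qed.

Lemma csumP (a : C) u v : u \in @l1_seq R -> v \in @l1_seq R ->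
  csum (fun n => a * u n + v n) = a * csum u + csum v.
Proof.
move=> cu cv; apply: cvg_lim => //.
rewrite (_ : series _ = (a *: series u) + series v :> (nat -> C)).
  apply: cvgD; last exact: csum_cvg.
  exact: (cvgZl_tmp (k := a) (csum_cvg cu)).
by apply/funext => n; rewrite /series/= big_split/= -mulr_sumr.
Qed.

Lemma csum_le u (M : R) :
  (forall N, \sum_(n < N) rnorm (u n) <= M) -> rnorm (csum u) <= M.
Proof.
move=> uM; have cu := csum_cvg (l1_seq_of_bounded uM).
apply/ler_addgt0Pr => e e0.
have e0' : 0 < e%:C :> R[i] by rewrite ltcR.
move/cvgrPdist_lt: cu => /(_ _ e0')[N _ /(_ N (leqnn N))].
rewrite -rnormE ltcR => /ltW uN.
rewrite -[csum u](subrK (series u N)) addrC (le_trans (rnormD _ _))//.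
rewrite lerD// (le_trans _ (uM N))// /series/= big_mkord.
exact: rnorm_sum.
Qed.

Lemma csum_single u i : (forall n, n != i -> u n = 0) -> csum u = u i.
Proof.
move=> ui; apply: cvg_lim => //.
apply: cvg_near_cst; near=> n.
have lt_in : (i < n)%N by near: n; exists i.+1.
rewrite /series/= big_mkord (bigD1 (Ordinal lt_in))//= big1 ?addr0// => k.
by rewrite -val_eqE/= => /ui.
Unshelve. all: by end_near. Qed.

Lemma mul_l1_le (b : nat -> C) (M : R) x N : (forall n, rnorm (b n) <= M) ->
  \sum_(n < N) rnorm (b n * x n) <= M * rnorm x.
Proof.
move=> bM.
have M0 : 0 <= M by exact: le_trans (rnorm_ge0 _) (bM 0%N).
rewrite (@le_trans _ _ (M * \sum_(n < N) rnorm (x n)))//.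
  by rewrite mulr_sumr ler_sum// => n _; rewrite rnormM ler_wpM2r ?rnorm_ge0.
by rewrite ler_wpM2l// l1_partial_le.
Qed.

Lemma mul_l1_seq (b : nat -> C) (M : R) x : (forall n, rnorm (b n) <= M) ->
  (fun n => b n * x n) \in @l1_seq R.
Proof. by move=> bM; apply: l1_seq_of_bounded => N; exact: (mul_l1_le x N bM). Qed.

(** ** Unit vectors *)

Lemma unit_subproof n : (fun k => (k == n)%:R : C) \in @l1_seq R.
Proof.
apply: (@l1_seq_of_bounded _ 1) => N.
have [lt_nN|le_Nn] := ltnP n N; last first.
  rewrite big1 ?ler01// => k _.
  by rewrite ltn_eqF ?rnorm0// (leq_trans (ltn_ord k)).
rewrite (bigD1 (Ordinal lt_nN))//= eqxx rnorm1 big1 ?addr0// => k.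
by rewrite -val_eqE/= => /negbTE ->; rewrite rnorm0.
Qed.

Definition unit_vec n : l1 := L1 (unit_subproof n).

Local Notation e_ := unit_vec.

Lemma unit_vecE n k : e_ n k = (k == n)%:R.
Proof. by []. Qed.

(* Simplification would otherwise expose the underlying sequence. *)
Opaque unit_vec.

Lemma l1_scaleE (a : C) x k : (a *: x : l1) k = a * x k.
Proof. by []. Qed.

Lemma l1_subE x y k : (x - y : l1) k = x k - y k.
Proof. by []. Qed.

Lemma l1_sumE (I : Type) (s : seq I) (P : pred I) (F : I -> l1) k :
  (\sum_(i <- s | P i) F i) k = \sum_(i <- s | P i) F i k.
Proof. by elim/big_rec2: _ => // i a b _ <-. Qed.

Lemma rnorm_unit n : rnorm (e_ n) <= 1.
Proof.
apply: l1_norm_le => N.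
have [lt_nN|le_Nn] := ltnP n N; last first.
  rewrite big1 ?ler01// => k _.
  by rewrite unit_vecE ltn_eqF ?rnorm0// (leq_trans (ltn_ord k)).
rewrite (bigD1 (Ordinal lt_nN))//= unit_vecE eqxx rnorm1 big1 ?addr0// => k.
by rewrite -val_eqE/= unit_vecE => /negbTE ->; rewrite rnorm0.
Qed.

Definition trunc N x : l1 := \sum_(n < N) x n *: e_ n.

Lemma truncE N x k : trunc N x k = if (k < N)%N then x k else 0.
Proof.
rewrite /trunc l1_sumE (eq_bigr (fun i : 'I_N => x i * (k == i)%:R)); last first.
  by move=> i _; rewrite l1_scaleE unit_vecE.
case: ltnP => kN; last first.
  by rewrite big1// => i _; rewrite gtn_eqF ?mulr0// (leq_trans (ltn_ord i)).
rewrite (bigD1 (Ordinal kN))//= eqxx mulr1 big1 ?addr0// => i.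
by rewrite -val_eqE/= eq_sym => /negbTE ->; rewrite mulr0.
Qed.

Lemma trunc_dist N x :
  rnorm (x - trunc N x) <= rnorm x - \sum_(n < N) rnorm (x n).
Proof.
have : forall k, (x - trunc N x) k = if (k < N)%N then 0 else x k.
  by move=> k; rewrite l1_subE truncE; case: ifP; rewrite ?subrr ?subr0.
move: (x - trunc N x) => y yE.
apply: l1_norm_le => M; rewrite lerBrDr.
rewrite (le_trans _ (l1_partial_le x (N + M)))//.
rewrite [leRHS]big_split_ord/= [leLHS]addrC lerD2l.
rewrite (@le_trans _ _ (\sum_(n < N + M) rnorm (y n)))//.
  rewrite -!(big_mkord xpredT (fun n => rnorm (y n))).
  rewrite (@big_cat_nat _ _ _ M 0 (N + M))//= ?leq_addl// lerDl.
  by rewrite sumr_ge0// => *; rewrite rnorm_ge0.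
rewrite big_split_ord/= big1 ?add0r => [|i _]; last by rewrite yE ltn_ord rnorm0.
by apply: ler_sum => i _; rewrite yE ltnNge leq_addr.
Qed.

Lemma trunc_cvg x (e : R) : 0 < e -> exists N, rnorm (x - trunc N x) < e.
Proof.
move=> /(l1_partial_gt x)[N xN]; exists N.
by rewrite (le_lt_trans (trunc_dist _ _))// ltrBlDr -ltrBlDl.
Qed.

(** ** Functionals *)

(** Truncations are dense, so the coordinates of a functional control its norm:
    this identifies the dual with the bounded sequences. *)
Lemma dual_norm_le (G : dual l1) (M : R) :
  (forall n, rnorm (G (e_ n)) <= M) -> rnorm G <= M.
Proof.
move=> GM.
have M0 : 0 <= M by exact: le_trans (rnorm_ge0 _) (GM 0%N).
have Gx x : rnorm (G x) <= M * rnorm x.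
  apply/ler_addgt0Pr => e e0.
  have d0 : 0 < e / (rnorm G + 1) by rewrite divr_gt0// ltr_wpDl// rnorm_ge0.
  have [N xN] := trunc_cvg x d0.
  rewrite -[x in G x](subrK (trunc N x)) linearD addrC.
  rewrite (le_trans (rnormD _ _))// lerD//.
    rewrite linear_sum (le_trans (rnorm_sum _ _ _))//.
    rewrite (le_trans _ (ler_wpM2l M0 (l1_partial_le x N)))// mulr_sumr.
    by apply: ler_sum => i _; rewrite linearZ/= rnormZ mulrC ler_wpM2r ?rnorm_ge0.
  rewrite (le_trans (dual_le _ _))//.
  rewrite ltr_pdivlMr ?ltr_wpDl ?rnorm_ge0// in xN.
  by rewrite (le_trans _ (ltW xN))// mulrC ler_wpM2l ?rnorm_ge0// lerDl.
rewrite dual_normE; apply: ge_sup; first exact: dual_range_neq0.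
move=> _ [x /= x1 <-]; rewrite (le_trans (Gx x))//.
by rewrite ler_piMr.
Qed.

Lemma dual_eq (F G : dual l1) : (forall n, F (e_ n) = G (e_ n)) -> F = G.
Proof.
move=> FG; apply/eqP; rewrite -subr_eq0; apply/eqP/rnorm0_eq0.
apply/eqP; rewrite eq_le rnorm_ge0 andbT; apply: dual_norm_le => n.
by rewrite -[(F - G) _]/(F (e_ n) - G (e_ n)) FG subrr rnorm0.
Qed.

Lemma dual_addE (F G : dual l1) x : (F + G) x = F x + G x.
Proof. by []. Qed.

Lemma dual_subE (F G : dual l1) x : (F - G) x = F x - G x.
Proof. by []. Qed.

Lemma dual_scaleE (a : C) (F : dual l1) x : (a *: F) x = a * F x.
Proof. by []. Qed.

Lemma dual_sumE (I : Type) (s : seq I) (P : pred I) (F : I -> dual l1) x :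
  (\sum_(i <- s | P i) F i) x = \sum_(i <- s | P i) F i x.
Proof. by elim/big_rec2: _ => // i a b _ <-. Qed.

Lemma bool_rnorm_le1 (b : bool) : rnorm (b%:R : C) <= 1.
Proof. by case: b; rewrite ?rnorm1 ?rnorm0 ?ler01. Qed.

Definition ind_fun (A : pred nat) x : C := csum (fun n => (A n)%:R * x n).

Lemma ind_fun_linear A : linear (ind_fun A).
Proof.
move=> a x y; rewrite -[RHS]/(a * ind_fun A x + ind_fun A y) -csumP.
- by congr csum; apply/funext => n; rewrite -[(_ + _ : l1) _]/(a * x n + y n); ring.
- exact: (mul_l1_seq x (fun n => bool_rnorm_le1 (A n))).
- exact: (mul_l1_seq y (fun n => bool_rnorm_le1 (A n))).
Qed.

Lemma ind_dual A : ind_fun A \in @dual_fun R l1.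
Proof.
apply/mem_set; split; first exact: ind_fun_linear.
pose L := GRing.isLinear.Build R[i] l1 C *:%R (ind_fun A) (ind_fun_linear A).
pose F : {linear l1 -> C} := HB.pack (ind_fun A) L.
apply: (@bounded_linear_continuous R[i] l1 C F); apply/bounded_funP => r.
exists r => x; apply: le_trans; rewrite -!rnormE lecR -[rnorm x]mul1r.
by apply: csum_le => N; exact: (mul_l1_le x N (fun n => bool_rnorm_le1 (A n))).
Qed.

Definition ind A : dual l1 := Dual (ind_dual A).

Lemma indE A n : ind A (e_ n) = (A n)%:R.
Proof.
rewrite -[LHS]/(csum _) (@csum_single _ n) => [|k kn]; rewrite unit_vecE.
  by rewrite eqxx mulr1.
by rewrite (negbTE kn) mulr0.
Qed.

Lemma ind1E n x : ind (pred1 n) x = x n.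
Proof.
rewrite -[LHS]/(csum _) (@csum_single _ n) => [|k kn] /=.
  by rewrite eqxx mul1r.
by rewrite (negbTE kn) mul0r.
Qed.

(** ** Lower triangular bilinear forms *)

(** Pairing a coordinate with no later one keeps the inner sum finite, so that
    a single infinite sum defines the form. *)
Definition lower_form (r : rel nat) x y : C :=
  csum (fun n => (\sum_(i < n.+1 | r n i) y i) * x n).

Lemma lower_coef_le (r : rel nat) y n : rnorm (\sum_(i < n.+1 | r n i) y i) <= rnorm y.
Proof.
rewrite (le_trans (rnorm_sum _ _ _))// (le_trans _ (l1_partial_le y n.+1))//.
by rewrite big_mkcond ler_sum// => i _; case: ifP => // _; rewrite rnorm_ge0.
Qed.

Lemma lower_form_bilinear r : bounded_bilinear (lower_form r) 1.
Proof.
split=> //.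
- move=> y a x x'.
  rewrite -[RHS]/(a * lower_form r x y + lower_form r x' y) -csumP.
  + congr csum; apply/funext => n.
    by rewrite -[(_ + _ : l1) _]/(a * x n + x' n); ring.
  + exact: (mul_l1_seq x (lower_coef_le r y)).
  + exact: (mul_l1_seq x' (lower_coef_le r y)).
- move=> x a y y'.
  rewrite -[RHS]/(a * lower_form r x y + lower_form r x y') -csumP.
  + congr csum; apply/funext => n.
    by rewrite mulrA -mulrDl mulr_sumr -big_split.
  + exact: (mul_l1_seq x (lower_coef_le r y)).
  + exact: (mul_l1_seq x (lower_coef_le r y')).
- move=> x y; rewrite mul1r mulrC.
  by apply: csum_le => N; exact: (mul_l1_le x N (lower_coef_le r y)).
Qed.

Lemma lower_form_unit r i j :
  lower_form r (e_ i) (e_ j) = (r i j && (j <= i)%N)%:R.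
Proof.
rewrite /lower_form (@csum_single _ i) => [|k ki]; last first.
  by rewrite unit_vecE (negbTE ki) mulr0.
rewrite unit_vecE eqxx mulr1; have [le_ji|lt_ij] := leqP j i.
  rewrite andbT big_mkcond (bigD1 (Ordinal (le_ji : (j < i.+1)%N)))//= big1.
    by rewrite addr0 unit_vecE eqxx; case: (r i j).
  by move=> k; rewrite -val_eqE/= unit_vecE => /negbTE ->; case: ifP.
rewrite andbF big1// => k _; rewrite unit_vecE ltn_eqF//.
exact: leq_trans (ltn_ord k) lt_ij.
Qed.

End EllOneSums.

(* Simplification would otherwise expose the underlying sequences and sums. *)
Global Opaque unit_vec ind.

(** * Finite colorings *)

Section Colorings.
Context {R : realType}.
Local Notation C := (Cplx R).
Local Notation l1 := (l1 R).
Local Notation e_ := (@unit_vec R).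

Lemma real_coloring (f : nat -> R) (M e : R) : (forall n, `|f n| <= M) -> 0 < e ->
  exists (T : finType) (c : nat -> T), forall m n, c m = c n -> `|f m - f n| <= e.
Proof.
move=> fM e0.
pose g n := (f n + M) / e.
have g0 n : 0 <= g n.
  by rewrite divr_ge0 ?(ltW e0)//; have := fM n; rewrite ler_norml => /andP[h1 h2]; lra.
pose K := Num.truncn ((M + M) / e).
have gK n : (Num.truncn (g n) < K.+1)%N.
  have /truncn_itv/andP[gn _] := g0 n.
  have MM : g n <= (M + M) / e.
    rewrite ler_pM2r ?invr_gt0// lerD2r.
    by have := fM n; rewrite ler_norml => /andP[].
  have /truncn_itv/andP[_ lt_K] : 0 <= (M + M) / e by exact: le_trans MM.
  by rewrite -(ltr_nat R) (le_lt_trans gn)// (le_lt_trans MM).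
exists 'I_K.+1, (fun n => Ordinal (gK n)) => m n /(congr1 val)/= gmn.
have /truncn_itv/andP[m1 m2] := g0 m; have /truncn_itv/andP[n1 n2] := g0 n.
rewrite gmn -natr1 in m1 m2; rewrite -natr1 in n2.
have fE k : f k = g k * e - M by rewrite divfK ?gt_eqF// addrK.
have -> : f m - f n = (g m - g n) * e by rewrite !fE; ring.
rewrite normrM (gtr0_norm e0).
by rewrite ler_piMl ?(ltW e0)// ler_norml; apply/andP; split; lra.
Qed.

(** Functionals on absolutely summable sequences are bounded sequences, so
    finitely many of them are uniformly close to functions of a single finite
    coloring of the indices. *)
Lemma dual_coloring (s : seq (dual l1)) (e : R) : 0 < e ->
  exists (T : finType) (c : nat -> T), forall F, F \in s ->
    forall m n, c m = c n -> rnorm (F (e_ m) - F (e_ n)) <= e.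
Proof.
move=> e0; elim: s => [|F s [T [c cs]]].
  by exists unit, (fun=> tt).
have FM n : rnorm (F (e_ n)) <= rnorm F.
  by rewrite (le_trans (dual_le _ _))// ler_piMr ?rnorm_ge0// rnorm_unit.
have e20 : 0 < e / 2 by rewrite divr_gt0.
have [T1 [c1 c1P]] := real_coloring (fun n => le_trans (Re_le_rnorm _) (FM n)) e20.
have [T2 [c2 c2P]] := real_coloring (fun n => le_trans (Im_le_rnorm _) (FM n)) e20.
exists (T * (T1 * T2))%type, (fun n => (c n, (c1 n, c2 n))) => G.
rewrite inE => /orP[/eqP-> m n [_ e1 e2]|Gs m n [e1 _ _]]; last exact: cs.
rewrite (le_trans (rnorm_le_ReIm _))// ReB ImB [e]splitr.
by rewrite lerD ?c1P ?c2P.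
Qed.

End Colorings.

(** * Singular functionals *)

Section Singular.
Context {R : realType}.
Local Notation C := (Cplx R).
Local Notation l1 := (l1 R).
Local Notation e_ := (@unit_vec R).
Local Notation ind := (@ind R).
Implicit Types (mu z : bidual l1) (A : pred nat).

Definition color_class (T : eqType) (c : nat -> T) (t : T) : pred nat :=
  fun k => c k == t.

Lemma rnorm_embed (x : l1) : rnorm (bidual_embed x) <= rnorm x.
Proof.
rewrite dual_normE; apply: ge_sup; first exact: dual_range_neq0.
move=> _ [F /= F1 <-]; rewrite (le_trans (dual_le F x))//.
by rewrite ler_piMl ?rnorm_ge0.
Qed.

(** Indicators of disjoint sets, combined with norming coefficients, form a
    functional of norm at most one.  Seen on indicators, a bidual element is thus
    a finitely additive measure of total variation at most its norm. *)
Lemma variation_le mu (I : finType) (A : I -> pred nat) :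
  (forall i j k, A i k -> A j k -> i = j) ->
  \sum_i rnorm (mu (ind (A i))) <= rnorm mu.
Proof.
move=> dA.
have /choice[s sP] : forall i, exists s : C, rnorm s <= 1 /\
    s * mu (ind (A i)) = (rnorm (mu (ind (A i))))%:C :> R[i].
  by move=> i; have [s s1 sE] := norming_scalar (mu (ind (A i))); exists s.
pose G := \sum_i s i *: ind (A i).
have G1 : rnorm G <= 1.
  apply: dual_norm_le => n.
  rewrite /G dual_sumE (eq_bigr (fun i => s i * (A i n)%:R)); last first.
    by move=> i _; rewrite dual_scaleE indE.
  have [/existsP[i Ain]|/existsPn nA] := boolP [exists i, A i n].
    rewrite (bigD1 i)//= big1 ?addr0 => [|j ji].
      by rewrite Ain mulr1; exact: (sP i).1.
    case: (boolP (A j n)) => [Ajn|]; last by rewrite mulr0.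
    by rewrite (dA _ _ _ Ajn Ain) eqxx in ji.
  by rewrite big1 ?rnorm0 ?ler01// => i _; rewrite (negbTE (nA i)) mulr0.
have muG : mu G = (\sum_i rnorm (mu (ind (A i))))%:C :> R[i].
  rewrite /G linear_sum rmorph_sum; apply: eq_bigr => i _.
  by rewrite linearZ/= -(sP i).2.
have S0 : 0 <= \sum_i rnorm (mu (ind (A i))).
  by rewrite sumr_ge0// => i _; rewrite rnorm_ge0.
rewrite -(ger0_norm S0) -rnormR -muG (le_trans (dual_le _ _))//.
by rewrite ler_piMr ?rnorm_ge0.
Qed.

Definition singular mu := forall n, mu (ind (pred1 n)) = 0.

Lemma singular_tail mu A N : singular mu ->
  mu (ind (fun k => (N <= k)%N && A k)) = mu (ind A).
Proof.
move=> mu0.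
have -> : ind A = ind (fun k => (N <= k)%N && A k) +
    \sum_(n < N | A n) ind (pred1 (n : nat)).
  apply: dual_eq => k; rewrite dual_addE dual_sumE !indE.
  under eq_bigr do rewrite indE/=.
  have [le_Nk|lt_kN] := leqP N k.
    by rewrite big1 ?addr0// => n _; rewrite gtn_eqF// (leq_trans (ltn_ord n)).
  rewrite add0r big_mkcond (bigD1 (Ordinal lt_kN))//= eqxx big1 ?addr0.
    by case: (A k).
  by move=> i; rewrite -val_eqE/= eq_sym => /negbTE ->; case: ifP.
by rewrite linearD linear_sum big1 ?addr0// => n _; exact: mu0.
Qed.

Lemma singular_nonnull mu A N : singular mu -> mu (ind A) != 0 ->
  exists k, (N <= k)%N && A k.
Proof.
move=> mu0; rewrite -(singular_tail A N mu0) => muA.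
apply/not_existsP => nA; move/negP: muA; apply.
rewrite (_ : ind _ = 0) ?linear0//.
by apply: dual_eq => k; rewrite indE; have /negP/negbTE -> := nA k.
Qed.

(** The masses of the points form a summable sequence [x], and removing it
    leaves a measure that does not see finite sets.  The norms add up because the
    first [N] points carry nearly all of [x], while the singular part lives
    on what lies beyond them. *)
Lemma yosida_hewitt z : exists (x : l1) (mu : bidual l1),
  [/\ forall F : dual l1, z F = F x + mu F, singular mu &
  forall (T : finType) (c : nat -> T),
    rnorm x + \sum_t rnorm (mu (ind (color_class c t))) <= rnorm z].
Proof.
pose u (n : nat) : C := z (ind (pred1 n)).
have zx N : \sum_(n < N) rnorm (u n) <= rnorm z.
  apply: (@variation_le z 'I_N (fun n => pred1 (n : nat))) => i j k /eqP -> /eqP.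
  exact: val_inj.
pose x := L1 (l1_seq_of_bounded zx).
have xE n : x n = u n by [].
pose mu := z - bidual_embed x.
have muE F : mu F = z F - F x by [].
have mu0 : singular mu by move=> n; rewrite muE ind1E xE /u subrr.
exists x, mu; split=> //; first by move=> F; rewrite muE addrC subrK.
move=> T c; apply/ler_addgt0Pr => e e0.
have e20 : 0 < e / 2 by rewrite divr_gt0.
have [N xN] := l1_partial_gt x e20.
pose A t : pred nat := fun k => (N <= k)%N && color_class c t k.
have dA i j k : A i k -> A j k -> i = j.
  by move=> /andP[_ /eqP <-] /andP[_ /eqP <-].
pose A' (i : 'I_N + T) : pred nat :=
  match i with inl n => pred1 (n : nat) | inr t => A t end.
have := @variation_le z _ A'.
rewrite big_sumType/= => /(_ _)/wrap[].
  move=> [n|t] [n'|t'] k /=.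
  - by move=> /eqP -> /eqP/val_inj ->.
  - by move=> /eqP -> /andP[]; rewrite leqNgt ltn_ord.
  - by move=> + /eqP kn; rewrite kn => /andP[]; rewrite leqNgt ltn_ord.
  - by move=> ti tj; rewrite (dA _ _ _ ti tj).
rewrite -[X in X + _]/(\sum_(n < N) rnorm (x n)) => zN.
(* Only the tail of x meets the classes cut at N, so its contribution is the
   variation of a vector of small norm. *)
have xt : \sum_t rnorm (ind (A t) x) <= e / 2.
  rewrite (eq_bigr (fun t => rnorm (bidual_embed (x - trunc N x) (ind (A t))))).
    rewrite (le_trans (variation_le _ dA))// (le_trans (rnorm_embed _))//.
    by rewrite (le_trans (trunc_dist _ _))// lerBlDr addrC -lerBlDr ltW.
  move=> t _; rewrite -[X in _ = rnorm X]/(ind (A t) (x - trunc N x)) linearB.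
  rewrite [X in _ - X](_ : _ = 0) ?subr0// linear_sum big1// => n _.
  by rewrite linearZ/= indE /A leqNgt ltn_ord scaler0.
have mut t : rnorm (mu (ind (color_class c t))) <=
    rnorm (z (ind (A t))) + rnorm (ind (A t) x).
  by rewrite -(singular_tail _ N mu0) muE rnormB.
have := ler_sum (index_enum T) (fun t (_ : true) => mut t).
rewrite big_split/= => muS.
lra.
Qed.

(** Replacing each color class by one of its points turns the integral against
    [mu] into a finite combination of point values. *)
Lemma simple_approx mu (F : dual l1) (T : finType) (c : nat -> T) (n : T -> nat)
    (e : R) :
  (forall i j, c i = c j -> rnorm (F (e_ i) - F (e_ j)) <= e) ->
  (forall t, mu (ind (color_class c t)) != 0 -> c (n t) = t) ->
  rnorm (mu F - \sum_t mu (ind (color_class c t)) * F (e_ (n t))) <= rnorm mu * e.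
Proof.
move=> Fe cn.
have /choice[r rP] : forall t, exists r, forall k, c k = t -> c r = t.
  move=> t; have [[k ck]|nc] := pselect (exists k, c k = t); first by exists k.
  by exists 0%N => k ck; case: nc; exists k.
(* Null classes need not contain their point; there any other one will do. *)
pose m t := if mu (ind (color_class c t)) == 0 then r t else n t.
have mP k : c (m (c k)) = c k.
  rewrite /m; case: ifPn => [_|/cn //]; exact: (rP _ k).
pose H := \sum_t F (e_ (m t)) *: ind (color_class c t).
have FH : rnorm (F - H) <= e.
  apply: dual_norm_le => k; rewrite dual_subE.
  rewrite /H dual_sumE (eq_bigr (fun t => F (e_ (m t)) * (c k == t)%:R)); last first.
    by move=> t _; rewrite dual_scaleE indE.
  rewrite (bigD1 (c k))//= eqxx mulr1 big1 ?addr0.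
    exact: Fe.
  by move=> t; rewrite eq_sym => /negbTE ->; rewrite mulr0.
have -> : \sum_t mu (ind (color_class c t)) * F (e_ (n t)) = mu H.
  rewrite /H linear_sum; apply: eq_bigr => t _ /=.
  rewrite linearZ/= -[RHS]/(_ * _) mulrC /m.
  by case: eqP => // ->; rewrite !mulr0.
rewrite -linearB (le_trans (dual_le _ _))//.
by rewrite ler_wpM2l ?rnorm_ge0.
Qed.

End Singular.

(** * Cluster values at points with a singular part *)

Section SingularPart.
Context {R : realType}.
Local Notation C := (Cplx R).
Local Notation l1 := (l1 R).
Local Notation e_ := (@unit_vec R).
Local Notation ind := (@ind R).

Variables (z : bidual l1) (x : l1) (mu : bidual l1).
Hypothesis z1 : rnorm z <= 1.
Hypothesis zE : forall F : dual l1, z F = F x + mu F.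
Hypothesis mu_sing : singular mu.
Hypothesis mu_var : forall (T : finType) (c : nat -> T),
  rnorm x + \sum_t rnorm (mu (ind (color_class c t))) <= rnorm z.

Definition class_mass (T : finType) (c : nat -> T) (t : T) : C :=
  mu (ind (color_class c t)).

(** Null classes are exempt: they may be finite or empty, and their points carry
    no mass. *)
Definition represents (T : finType) (c : nat -> T) (n : T -> nat) :=
  forall t, class_mass c t != 0 -> c (n t) = t.

Definition point_masses (T : finType) (c : nat -> T) (n : T -> nat) : l1 :=
  \sum_t class_mass c t *: e_ (n t).

(** The coloring adapted to the neighbourhood may be refined freely, which leaves
    room to separate further sets before the points are chosen. *)
Lemma point_masses_approx (s : seq (dual l1)) (e : R) : 0 < e ->
  exists (T : finType) (c : nat -> T), forall (T' : finType) (d : nat -> T')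
    (n : T' -> nat), (forall i j, d i = d j -> c i = c j) -> represents d n ->
    rnorm (x + point_masses d n) <= 1 /\
    forall F, F \in s -> rnorm (F (x + point_masses d n) - z F) < e.
Proof.
move=> e0.
have m0 : 0 < rnorm mu + 1 by rewrite ltr_wpDl// rnorm_ge0.
have [T [c cP]] := dual_coloring s (divr_gt0 e0 m0).
exists T, c => T' d n dc dn; split.
  rewrite (le_trans (rnormD _ _))// (le_trans _ z1)// (le_trans _ (mu_var d))//.
  rewrite lerD2l (le_trans (rnorm_sum _ _ _))// ler_sum// => t _.
  by rewrite rnormZ ler_piMr ?rnorm_ge0// rnorm_unit.
move=> F Fs.
have Fe i j : d i = d j -> rnorm (F (e_ i) - F (e_ j)) <= e / (rnorm mu + 1).
  by move=> /dc; exact: cP.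
have FE : F (point_masses d n) = \sum_t mu (ind (color_class d t)) * F (e_ (n t)).
  by rewrite linear_sum; apply: eq_bigr => t _; rewrite linearZ.
have -> : F (x + point_masses d n) = F x + F (point_masses d n) by exact: linearD.
rewrite zE FE opprD addrACA subrr add0r rnormBC.
rewrite (le_lt_trans (simple_approx Fe dn))//.
by rewrite mulrA ltr_pdivrMr// mulrC ltr_pM2l// ltrDl.
Qed.

Lemma represents_far (T : finType) (c : nat -> T) N :
  exists n, represents c n /\ forall t, class_mass c t != 0 -> (N <= n t)%N.
Proof.
have /choice[n nP] : forall t, exists k, class_mass c t != 0 ->
    (N <= k)%N && (c k == t).
  move=> t; have [_|/(singular_nonnull N mu_sing)[k kP]] := eqVneq (class_mass c t) 0.
    by exists 0%N.
  by exists k => _; exact: kP.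
by exists n; split=> t /nP/andP[] // _ /eqP.
Qed.

(** Non-null classes are infinite, so their representatives can be chosen in
    any prescribed order. *)
Lemma represents_ordered (T : finType) (c : nat -> T) (p : pred T) :
  exists n, represents c n /\
    forall t u, class_mass c t != 0 -> class_mass c u != 0 -> p t -> ~~ p u ->
      (n t < n u)%N.
Proof.
have [n1 [n1c _]] := represents_far c 0.
have [n2 [n2c n2P]] := represents_far c (\max_t n1 t).+1.
exists (fun t => if p t then n1 t else n2 t); split=> [t t0|t u t0 u0 -> /negbTE ->].
  by case: ifP => _; [exact: n1c|exact: n2c].
by rewrite (leq_ltn_trans _ (n2P _ u0))// leq_bigmax.
Qed.

Lemma lower_form_point_masses (r : rel nat) (T : finType) (c : nat -> T)
    (n : T -> nat) :
  lower_form r (point_masses c n) (point_masses c n) =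
  \sum_t \sum_u class_mass c t * class_mass c u *
    (r (n t) (n u) && (n u <= n t)%N)%:R.
Proof.
have rB := lower_form_bilinear (R := R) r.
rewrite (bil_suml rB); apply: eq_bigr => t _.
rewrite (bil_sumr rB); apply: eq_bigr => u _.
by rewrite (bilZl rB) (bilZr rB) lower_form_unit mulrA.
Qed.

Lemma mass_of_classes (T : finType) (c : nat -> T) (n : T -> nat) (A : pred nat) :
  (forall i j, c i = c j -> A i = A j) -> represents c n ->
  mu (ind A) = \sum_t class_mass c t * (A (n t))%:R.
Proof.
move=> cA cn; apply/eqP; rewrite -subr_eq0; apply/eqP/rnorm0_eq0/eqP.
rewrite eq_le rnorm_ge0 andbT -(mulr0 (rnorm mu)).
have Ae i j : c i = c j -> rnorm (ind A (e_ i) - ind A (e_ j)) <= 0.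
  by move=> /cA; rewrite !indE => ->; rewrite subrr rnorm0.
have := simple_approx Ae cn.
by under eq_bigr do rewrite indE.
Qed.

(** Two disjoint sets of nonzero mass: the form pairing a coordinate in [A']
    with an earlier one in [A] sees which of the two sets has its
    representatives first, an order that weak-star neighbourhoods do not
    control. *)
Lemma fiber_two_pieces (A A' : pred nat) : (forall k, ~~ (A k && A' k)) ->
  mu (ind A) != 0 -> mu (ind A') != 0 -> [set: R] #<= fiber z.
Proof.
move=> dA muA muA'.
pose r : rel nat := fun i j => A' i && A j.
have rB := lower_form_bilinear (R := R) r.
suff H (b : bool) :
    cluster_value z (quad_Au rB x) (mu (ind A') * mu (ind A) * b%:R).
  apply: fiber_continuum (H false) (H true).
  by rewrite mulr0 mulr1 eq_sym mulf_neq0.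
apply: quad_cluster => s e e0.
have [T [c cP]] := point_masses_approx s e0.
pose d k := (c k, A k, A' k).
have [n [dn nP]] := represents_ordered d (fun t => t.1.2 == b).
have [|y1 yF] := cP _ d n _ dn; first by move=> i j [].
exists (x + point_masses d n); split=> //.
rewrite addrAC subrr add0r lower_form_point_masses.
rewrite (@mass_of_classes _ d n A')//; last by move=> i j [].
rewrite (@mass_of_classes _ d n A)//; last by move=> i j [].
rewrite -mulrA mulr_suml; apply: eq_bigr => t _.
rewrite mulr_suml mulr_sumr; apply: eq_bigr => u _.
have [->|t0] := eqVneq (class_mass d t) 0; first by rewrite !mul0r.
have [->|u0] := eqVneq (class_mass d u) 0; first by rewrite mulr0 !mul0r mulr0.
have -> (a a' b1 b2 b3 : C) : a * b1 * (a' * b2 * b3) = a * a' * (b1 * (b2 * b3)).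
  by ring.
congr (_ * _); rewrite -!natrM !mulnb; congr (nat_of_bool _)%:R.
rewrite /r -andbA; have [A't/=|//] := boolP (A' (n t)).
have [Au/=|//] := boolP (A (n u)).
have nAt : t.1.2 = false.
  rewrite -(dn t t0) /=; apply/negbTE; apply: contra (dA (n t)) => ->.
  by rewrite A't.
have Au' : u.1.2 by rewrite -(dn u u0).
case: b nP {y1 yF} => nP.
  by rewrite ltnW// nP// ?nAt// Au'.
by rewrite leqNgt nP ?nAt// Au'.
Qed.

(** Here [mu] is a multiple of an ultrafilter, so a single color class carries
    all the mass; splitting this mass between two points of the class halves the
    sum of the squares of the coordinates. *)
Lemma fiber_one_atom (A : pred nat) : mu (ind A) != 0 ->
  (forall A1 A2 : pred nat, (forall k, ~~ (A1 k && A2 k)) ->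
    mu (ind A1) != 0 -> mu (ind A2) = 0) ->
  [set: R] #<= fiber z.
Proof.
move=> muA atom.
pose m := mu (ind predT).
have m0 : m != 0.
  have -> : m = mu (ind A) + mu (ind (predC A)).
    rewrite -linearD; congr (mu _); apply: dual_eq => k.
    by rewrite dual_addE !indE /=; case: (A k); rewrite ?addr0 ?add0r.
  by rewrite [X in _ + X](atom A)// ?addr0// => k; rewrite /= andbN.
pose r : rel nat := fun i j => i == j.
have rB := lower_form_bilinear (R := R) r.
have rE i j : lower_form r (e_ i) (e_ j) = (i == j)%:R.
  by rewrite lower_form_unit /r; case: eqP => // ->; rewrite leqnn.
have concentrated (T : finType) (c : nat -> T) :
    exists t, class_mass c t != 0 /\
      forall n, represents c n -> point_masses c n = m *: e_ (n t).
  have [t t0|c0] := pickP (fun t => class_mass c t != 0); last first.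
    have [n [cn _]] := represents_far c 0.
    move: m0; rewrite /m (@mass_of_classes _ c n predT)// big1 ?eqxx// => t _.
    by have /negbFE/eqP -> := c0 t; rewrite mul0r.
  have c0 u : u != t -> class_mass c u = 0.
    move=> ut; apply: (atom (color_class c t)) => // k.
    by apply/negP => /andP[/eqP ct /eqP cu]; rewrite -ct -cu eqxx in ut.
  exists t; split=> // n cn.
  rewrite /point_masses (bigD1 t)//= big1 ?addr0 => [|u /c0 ->]; last first.
    by rewrite scale0r.
  congr (_ *: _); rewrite /m (@mass_of_classes _ c n predT)//.
  by rewrite (bigD1 t)//= mulr1 big1 ?addr0// => u /c0 ->; rewrite mul0r.
apply: (@fiber_continuum _ _ z (quad_Au rB x) (m * m) (m * m / 2)).
- rewrite -[X in X != _]mulr1 -subr_eq0 -mulrBr mulf_neq0// ?mulf_neq0//.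
  by rewrite subr_eq0 eq_sym invr_eq1 (eqr_nat _ 2 1).
- apply: quad_cluster => s e e0.
  have [T [c cP]] := point_masses_approx s e0.
  have [n [cn _]] := represents_far c 0.
  have [t [_ tP]] := concentrated _ c.
  have [//|y1 yF] := cP _ c n _ cn.
  exists (x + point_masses c n); split=> //.
  by rewrite addrAC subrr add0r tP// (bilZl rB) (bilZr rB) rE eqxx mulr1.
- apply: quad_cluster => s e e0.
  have [T [c cP]] := point_masses_approx s e0.
  have [t [t0 tP]] := concentrated _ c.
  have [n [cn _]] := represents_far c 0.
  have [n' [cn' n'P]] := represents_far c (n t).+1.
  have [//|y1 yF] := cP _ c n _ cn.
  have [//|y1' yF'] := cP _ c n' _ cn'.
  move: y1 yF y1' yF'; rewrite tP// tP// => y1 yF y1' yF'.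
  set y := x + _ in y1 yF; set y' := x + _ in y1' yF'.
  have h2 : rnorm (2^-1 : C) = 2^-1.
    rewrite -[2^-1]/(2^-1 : R[i]) (_ : 2^-1 = (2^-1 : R)%:C) ?rnormR ?ger0_norm//.
    by rewrite fmorphV rmorph_nat.
  have xh (V : lmodType R[i]) (v : V) : v = 2^-1 *: (v + v).
    by rewrite -mulr2n -(scaler_nat 2 v) scalerA mulVf ?scale1r// pnatr_eq0.
  exists (2^-1 *: (y + y')); split.
  + rewrite rnormZ h2 ler_pdivrMl// (le_trans (rnormD _ _))//.
    by rewrite mulr1 -[2]/(1 + 1) lerD.
  + move=> F Fs; rewrite linearZ linearD [z F]xh -scalerBr opprD addrACA.
    rewrite rnormZ h2 ltr_pdivrMl// (le_lt_trans (rnormD _ _))//.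
    by rewrite mulr_natl mulr2n ltrD ?yF ?yF'.
  + have -> : 2^-1 *: (y + y') - x = (2^-1 * m) *: (e_ (n t) + e_ (n' t)).
      rewrite [X in _ - X]xh -scalerBr opprD addrACA -scalerA; congr (_ *: _).
      by rewrite /y /y' 2!(addrAC x _ (- x)) subrr !add0r scalerDr.
    rewrite (bilZl rB) (bilZr rB) (bilDl rB) !(bilDr rB) !rE !eqxx.
    rewrite (ltn_eqF (n'P t t0)) eq_sym (ltn_eqF (n'P t t0)) /=.
    by field.
Qed.

End SingularPart.

(** * Fibers over the sphere *)

Theorem theorem4p2 (R : realType) (z : bidual (l1 R)) :
  (unit_sphere (bidual (l1 R)) `\` bidual_embed @` unit_sphere (l1 R)) z ->
  [set: R] #<= fiber z.
Proof.
move=> [z1 nz]; rewrite /unit_sphere/= in z1.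
have [x [mu [zE mu0 mu_var]]] := yosida_hewitt z.
have z1' : rnorm z <= 1 by rewrite z1.
have [|nA] := pselect (exists A, mu (ind (R := R) A) != 0); last first.
  exfalso; apply: nz.
  have muF F : mu F = 0.
    apply: rnorm0_eq0; apply/eqP; rewrite eq_le rnorm_ge0 andbT.
    apply/ler_addgt0Pr => e e0; rewrite add0r.
    have m0 : 0 < rnorm mu + 1 by rewrite ltr_wpDl// rnorm_ge0.
    have [T [c cP]] := dual_coloring [:: F] (divr_gt0 e0 m0).
    have cz t : mu (ind (color_class c t)) = 0.
      by apply/eqP; apply: contrapT => /negP ?; apply: nA; exists (color_class c t).
    have := @simple_approx _ mu F T c (fun=> 0%N) _ (cP F (mem_head _ _)).
    rewrite big1 => [|t _]; last by rewrite cz mul0r.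
    rewrite subr0 => muF; rewrite (le_trans (muF _))//.
      by move=> t; rewrite cz eqxx.
    by rewrite mulrA ler_pdivrMr// mulrC ler_pM2l// lerDl.
  have zx : z = bidual_embed x.
    by apply/val_inj/funext => F; rewrite /= [LHS]zE muF addr0.
  exists x => //; rewrite /unit_sphere/=; apply/eqP; rewrite eq_le.
  have -> : 1 <= rnorm x by rewrite -z1 zx rnorm_embed.
  rewrite andbT -z1.
  rewrite (le_trans _ (mu_var _ (fun=> tt)))// lerDl sumr_ge0// => t _.
  exact: rnorm_ge0.
move=> [A muA].
have [[[A1 A2] /= [dA [mu1 mu2]]]|nd] := pselect (exists AA : pred nat * pred nat,
    (forall k, ~~ (AA.1 k && AA.2 k)) /\
    mu (ind (R := R) AA.1) != 0 /\ mu (ind (R := R) AA.2) != 0).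
  exact: (fiber_two_pieces z1' zE mu0 mu_var dA mu1 mu2).
apply: (fiber_one_atom z1' zE mu0 mu_var muA) => A1 A2 dA mu1.
apply/eqP; apply: contrapT => /negP mu2.
by apply: nd; exists (A1, A2).
Qed.
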